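(* Let $t\in(-1,0)$. Let $\Phi^{\mathrm{Planch}}_{\mathscr E}:\mathrm{Sym}^{\mathscr E}\to\mathbb R$ and $\Phi^{\mathrm{Planch}}_{\mathscr O}:\mathrm{Sym}^{\mathscr O}\to\mathbb R$ be the linear functionals defined on the power-sum basis by $$\Phi^{\mathrm{Planch}}_{\mathscr E}(p_\rho)=\begin{cases}1,&\rho=(2^n)\text{ for some }n\ge0,\\0,&\text{otherwise};\end{cases}\qquad \Phi^{\mathrm{Planch}}_{\mathscr O}(p_\rho)=\begin{cases}1,&\rho=(2^n,1)\text{ for some }n\ge0,\\0,&\text{otherwise}.\end{cases}$$ Then each $\Phi=\Phi^{\mathrm{Planch}}_{\mathscr E}$ (with $\star=\mathscr E$) and $\Phi=\Phi^{\mathrm{Planch}}_{\mathscr O}$ (with $\star=\mathscr O$) satisfies: ($p_2$-harmonicity) $\Phi(p_2F)=\Phi(F)$ for all $F\in\mathrm{Sym}^\star$; (positivity) $\Phi$ is nonnegative on the convex cone $C^{\mathrm{HL}}_\star(t)$.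
   Context: $\mathrm{Sym}$ is the graded $\mathbb R$-algebra of symmetric functions, freely generated by the power sums $p_1,p_2,\dots$; for a partition $\rho$, $p_\rho=\prod_i p_{\rho_i}$ (product over nonzero parts), and $\{p_\rho\}$ is a basis of $\mathrm{Sym}$. $(2^n)$ is the partition with $n$ parts equal to $2$; $(2^n,1)$ has $n$ parts equal to $2$ and one part $1$. $\mathrm{Sym}^{\mathscr E}$ and $\mathrm{Sym}^{\mathscr O}$ are the subspaces spanned by homogeneous elements of even and odd degree. For a partition $\lambda$: $n(\lambda)=\sum_i(i-1)\lambda_i$, $m_i(\lambda)=\#\{j:\lambda_j=i\}$ for $i\ge1$. The Hall–Littlewood function $P_\lambda(\,;t)\in\mathrm{Sym}$ is given in $N\ge\ell(\lambda)$ variables by $$P_\lambda(x_1,\dots,x_N;t)=\frac1{v_\lambda(t)}\sum_{w\in S_N}w\Bigl(x_1^{\lambda_1}\cdots x_N^{\lambda_N}\prod_{i<j}\frac{x_i-tx_j}{x_i-x_j}\Bigr),\quad v_\lambda(t)=\prod_{i\ge0}\prod_{j=1}^{m_i}\frac{1-t^j}{1-t},$$ with $m_0=N-\ell(\lambda)$, $m_i=m_i(\lambda)$ ($i\ge1$). Put $Q_\lambda(\,;t)=\prod_{i\ge1}\prod_{j=1}^{m_i(\lambda)}(1-t^j)\cdot P_\lambda(\,;t)$ and $\widetilde Q_\lambda(\,;t)=(-1)^{n(\lambda)}Q_\lambda(\,;t)$. $C^{\mathrm{HL}}_{\mathscr E}(t)\subset\mathrm{Sym}^{\mathscr E}$ (resp.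 $C^{\mathrm{HL}}_{\mathscr O}(t)\subset\mathrm{Sym}^{\mathscr O}$) is the convex cone spanned by all $\widetilde Q_\lambda(\,;t)$ with $|\lambda|$ even (resp. odd). *)

(* Defs.v *)
From HB Require Import structures.
From mathcomp Require Import all_boot all_order all_algebra all_fingroup.
From mathcomp Require Import boolp classical_sets reals finmap.
From mathcomp Require Import monalg mpoly.

Set Implicit Arguments.
Unset Strict Implicit.
Unset Printing Implicit Defensive.

Import Order.TTheory GRing.Theory Num.Theory.

Local Open Scope ring_scope.

Definition is_part (s : seq nat) : bool := sorted geq s && (0%N \notin s).

Record part := Part { part_val :> seq nat; _ : is_part part_val }.

HB.instance Definition _ := [isSub for part_val].
HB.instance Definition _ := [Choice of part by <:].

(* multiplicity m_i of the part i in la, seen as a sequence of N >= size la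
   integers padded with zeros *)
Definition mult (N : nat) (la : seq nat) (i : nat) : nat :=
  if i == 0%N then (N - size la)%N else count_mem i la.

Definition n_part (la : seq nat) : nat :=
  (\sum_(i < size la) i * nth 0 la i)%N.

(* The algebra of polynomials in variables indexed by nat; the variable of
   index i is the power sum p_(i+1) (so psum 0 is junk). *)
Notation Sym R := {malg R[{cmonom nat}]}.

Definition psum (R : realType) (k : nat) : Sym R := << @ucm nat k.-1 >>.

Definition psum_part (R : realType) (rho : seq nat) : Sym R :=
  \prod_(k <- rho) psum R k.

Definition cmonom_weight (m : {cmonom nat}) : nat :=
  (\sum_(i <- finsupp m) m i * i.+1)%N.

Definition homogeneous (R : realType) (d : nat) (F : Sym R) : Prop :=
  forall m, m \in monalg.msupp F -> cmonom_weight m = d.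

Definition linear_span (R : realType) (V : lmodType R) (A : set V) : set V :=
  [set v | exists (n : nat) (c : 'I_n -> R) (u : 'I_n -> V),
     (forall i, A (u i)) /\ v = \sum_(i < n) c i *: u i].

Definition convex_cone (R : realType) (V : lmodType R) (A : set V) : set V :=
  [set v | exists (n : nat) (c : 'I_n -> R) (u : 'I_n -> V),
     [/\ forall i, 0 <= c i, forall i, A (u i)
       & v = \sum_(i < n) c i *: u i]].

(* b = false: even degrees; b = true: odd degrees *)
Definition Sym_parity (R : realType) (b : bool) : set (Sym R) :=
  linear_span [set F : Sym R | exists2 d, odd d = b & homogeneous d F].

Section Specialization.
Variables (R : realType) (N : nat).

Definition psum_mon (m : {cmonom nat}) : (mpoly N R) :=
  \prod_(i <- finsupp m) (\sum_(j < N) 'X_j ^+ i.+1) ^+ m i.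

Lemma psum_monE (d : {fset nat}) (m : {cmonom nat}) :
  (finsupp m `<=` d)%fset ->
  psum_mon m = \prod_(i <- d) (\sum_(j < N) 'X_j ^+ i.+1) ^+ m i.
Proof.
move=> le; rewrite /psum_mon (big_fset_incl _ le) //= => i _.
by rewrite -cmE_eq0 => /eqP ->; rewrite expr0.
Qed.

Lemma psum_mon_mmorphism : monalg.mmorphism psum_mon.
Proof.
split=> [m1 m2|]; last by rewrite /psum_mon mdom1 big_seq_fset0.
have s1 : (finsupp m1 `<=` finsupp (mmul m1 m2))%fset.
  by rewrite mdomD fsubsetUl.
have s2 : (finsupp m2 `<=` finsupp (mmul m1 m2))%fset.
  by rewrite mdomD fsubsetUr.
rewrite (psum_monE s1) (psum_monE s2) /psum_mon -big_split /=.
by apply: eq_bigr => i _; rewrite cmM exprD.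
Qed.

HB.instance Definition _ :=
  monalg.isMultiplicative.Build {cmonom nat} (mpoly N R) psum_mon
    psum_mon_mmorphism.

Definition sym_eval : {rmorphism Sym R -> (mpoly N R)} :=
  monalg.mmap (@mpolyC N R) psum_mon.

Lemma sym_eval_psum (k : nat) :
  (0 < k)%N -> sym_eval (psum R k) = \sum_(j < N) 'X_j ^+ k.
Proof.
move=> k_gt0; rewrite /sym_eval /psum /= monalg.mmapU /= mpolyC1 mul1r.
by rewrite /psum_mon mdomU big_seq_fset1 cmUU expr1 prednK.
Qed.

Lemma sym_evalC (c : R) (F : Sym R) :
  sym_eval (c *: F) = c *: sym_eval F.
Proof. by rewrite /sym_eval /= monalg.mmapZ mul_mpolyC. Qed.

End Specialization.

(* The multinomial x ^ la and the sum over the symmetric group are evaluated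
   at a point x of K^N; they are used below at the generic point, with K the
   field of rational functions in N variables. *)
Definition HL_sum (K : fieldType) (N : nat) (t : K) (x : 'I_N -> K)
    (la : seq nat) : K :=
  \sum_(w : 'S_N)
    (\prod_(i < N) x (w i) ^+ nth 0%N la i) *
    \prod_(i < N) \prod_(j < N | (i < j)%N)
      ((x (w i) - t * x (w j)) / (x (w i) - x (w j))).

(* mult N la i = 0 for i > sumn la *)
Definition HL_v (R : realType) (N : nat) (t : R) (la : seq nat) : R :=
  \prod_(0 <= i < (sumn la).+1)
    \prod_(1 <= j < (mult N la i).+1) ((1 - t ^+ j) / (1 - t)).

Definition is_HL_P (R : realType) (t : R) (la : part) (P : Sym R) : Prop :=
  forall N : nat, (size la <= N)%N ->
    tofrac (sym_eval R N P) =
    tofrac ((HL_v N t la)^-1)%:MP *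
    HL_sum (tofrac t%:MP) (fun i : 'I_N => tofrac ('X_i : (mpoly N R))) la.

(* For -1 < t < 1 exactly one P satisfies is_HL_P t la P: it exists because the
   right-hand sides are symmetric polynomials compatible with setting the last
   variable to 0, and is unique because the sym_eval R N are jointly injective.
   The default value 0 of xget is then not used. *)
Definition HL_P (R : realType) (t : R) (la : part) : Sym R :=
  xget 0 [set P | is_HL_P t la P].

Definition HL_Q (R : realType) (t : R) (la : part) : Sym R :=
  (\prod_(1 <= i < (sumn la).+1)
     \prod_(1 <= j < (count_mem i (la : seq nat)).+1) (1 - t ^+ j)) *:
  HL_P t la.

Definition HL_Qtilde (R : realType) (t : R) (la : part) : Sym R :=
  (-1) ^+ n_part la *: HL_Q t la.

Definition HL_cone (R : realType) (b : bool) (t : R) : set (Sym R) :=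
  convex_cone
    [set F : Sym R | exists2 la : part, odd (sumn la) = b & F = HL_Qtilde t la].

Definition cmonom_part (m : {cmonom nat}) : seq nat :=
  sort geq (flatten [seq nseq (m i) i.+1 | i <- finsupp m]).

Lemma psum_partE (R : realType) (rho : seq nat) :
  psum_part R rho = << \big[mmul/mone]_(k <- rho) @ucm nat k.-1 >>.
Proof.
rewrite /psum_part; elim: rho => [|k rho IH]; first by rewrite !big_nil.
rewrite !big_cons IH /psum.
rewrite [LHS]monalg.malgM_def.
rewrite [LHS]monalg.fgmulUU.
by rewrite (_ : 1 * 1 = 1 :> R); [reflexivity | exact: mulr1].
Qed.

Lemma cmonom_partK (rho : part) :
  cmonom_part (\big[mmul/mone]_(k <- rho) @ucm nat k.-1) = rho.
Proof.
case: rho => rho /= /andP [srt n0].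
set m := (X in cmonom_part X).
have mE i : m i = count_mem i.+1 rho.
  rewrite {}/m; elim: rho n0 {srt} => [|k rho IH]; first by rewrite big_nil cm1.
  rewrite inE negb_or => /andP [k0 /IH {}IH].
  by rewrite big_cons cmM IH cmU /=; case: k k0.
have geq_anti : antisymmetric geq by move=> i j; rewrite -eqn_leq => /eqP.
have geq_trans : transitive geq by move=> j i k ij jk; apply: leq_trans ij.
apply: (sorted_eq geq_trans geq_anti _ srt).
  by apply: sort_sorted => i j; apply: leq_total.
rewrite perm_sort; apply/allP => k _ /=; apply/eqP.
rewrite count_flatten -map_comp sumnE big_map.
under eq_bigr => i _ do rewrite /= count_nseq /=.
case: k => [|k].
  by rewrite big1 // (count_memPn n0).
rewrite -mE; case: (mdomP m k) => k_m; last first.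
  rewrite big1_seq // => i /= i_m; case: eqP => // - [ik].
  by rewrite -ik i_m in k_m.
rewrite (big_fsetD1 k) //= eqxx mul1n big1_seq ?addn0 // => i /=.
by rewrite in_fsetD1 eqSS => /andP [/negbTE ->].
Qed.

(* The linear functional with value f rho on p_rho, for every partition rho. *)
Definition psum_functional (R : realType) (f : seq nat -> R) (F : Sym R) : R :=
  \sum_(m <- monalg.msupp F) monalg.mcoeff m F * f (cmonom_part m).

Lemma psum_functional_linear (R : realType) (f : seq nat -> R) (a : R)
    (F G : Sym R) :
  psum_functional f (a *: F + G) =
  a * psum_functional f F + psum_functional f G.
Proof.
pose d : {fset {cmonom nat}} := (monalg.msupp F `|` monalg.msupp G)%fset.
have extE (H : Sym R) : (monalg.msupp H `<=` d)%fset ->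
    psum_functional f H =
    \sum_(m <- d) monalg.mcoeff m H * f (cmonom_part m).
  move=> le; rewrite /psum_functional (big_fset_incl _ le) //= => m _.
  by move/mcoeff_outdom => ->; rewrite mul0r.
have dF : (monalg.msupp F `<=` d)%fset by apply: fsubsetUl.
have dG : (monalg.msupp G `<=` d)%fset by apply: fsubsetUr.
have daFG : (monalg.msupp (a *: F + G) `<=` d)%fset.
  apply: fsubset_trans (monalg.msuppD_le _ _) _; rewrite fsubUset dG andbT.
  exact: fsubset_trans (monalg.msuppZ_le _ _) dF.
rewrite !extE // mulr_sumr -big_split /=; apply: eq_bigr => m _.
by rewrite monalg.mcoeffD monalg.mcoeffZ mulrDl mulrA.
Qed.

Lemma psum_functionalE (R : realType) (f : seq nat -> R) (rho : part) :
  psum_functional f (psum_part R rho) = f rho.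
Proof.
rewrite psum_partE /psum_functional monalg.msuppU1 big_seq_fset1.
by rewrite monalg.mcoeffUU mul1r cmonom_partK.
Qed.

(* Linear on the whole of Sym R; only the restrictions to Sym_parity false and
   Sym_parity true, respectively, are meaningful. *)
Definition PlanchE (R : realType) : Sym R -> R :=
  psum_functional (fun rho => `[< exists n, rho = nseq n 2%N >]%:R).

Definition PlanchO (R : realType) : Sym R -> R :=
  psum_functional (fun rho => `[< exists n, rho = rcons (nseq n 2%N) 1%N >]%:R).

(* Main.v *)
(* Write Q_la = b_la P_la and let q_r be the coefficients of
   Q(u) = exp (sum_k (1 - t^k) p_k u^k / k).  Summing over the image of the first
   position, the symmetrization formula becomes Jing's recursion:
   Q_(m, la) = sum_s q_(m+s) [z^s] Q_la(q^z), where q^z has generating function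
   (1 - z u) / (1 - t z u) Q(u), so that a variable z is removed.  The recursion
   makes sense for all integer sequences, and gives the straightening rules
     Q_(s,s+1) = t Q_(s+1,s),
     Q_(s,s+2) = t Q_(s+2,s) + (t - 1) Q_(s+1,s+1).
   Both functionals are coefficients of the homomorphism Psi : Sym -> R[z] with
   p_1 |-> z, p_2 |-> 1 and p_k |-> 0 for k > 2: PlanchE is the coefficient of z^0
   and PlanchO that of z^1; since Psi(p_2) = 1, harmonicity is immediate.  If a_al
   is the coefficient of z^k in Psi(Q_al), Euler's identity for
   Psi(Q(u)) = exp ((1 - t) z u + (1 - t^2) u^2 / 2) reads
     (|al| - k) a_al = (1 - t^2) sum_i a_(al - 2 e_i).
   Straightening the terms coming from one block of equal parts of a partition
   leaves two partitions, obtained by removing two cells of one column, with a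
   negative coefficient, or two cells of adjacent columns or of one row, with a
   coefficient of the sign of t^m, where m is the distance of their rows.  Since
   t < 0, these are exactly the signs by which (-1)^n(la) changes, and positivity
   follows by induction on the size of the partition. *)

From HB Require Import structures.
From mathcomp Require Import all_boot all_order all_algebra all_fingroup.
From mathcomp Require Import boolp classical_sets reals finmap.
From mathcomp Require Import monalg mpoly.
From mathcomp Require Import ring lra zify.
Require Import Defs.

Set Implicit Arguments.
Unset Strict Implicit.
Unset Printing Implicit Defensive.

Import Order.TTheory GRing.Theory Num.Theory.
Local Open Scope ring_scope.

(** * Jing's operators *)

(** The linear map sending [z^s] to [q (m + s)]: it eliminates the variable [z] removed by the
    leading entry [m]. *)
Definition coef_pairing (A : comNzRingType) (q : int -> A) (m : int)
    (f : {poly A}) : A :=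
  \sum_(s < size f) q (m + s%:Z) * f`_s.

(* The coefficients of (1 - z) / (1 - t z). *)
Definition remove_coef (A : comNzRingType) (t : A) (i : nat) : A :=
  if i is j.+1 then t ^+ j * (t - 1) else 1.

(* q_neg below ensures that the truncation loses no coefficient. *)
Definition remove_var (A : comNzRingType) (t : A) (q : int -> A) (r : int) :
    {poly A} :=
  \poly_(i < (absz r).+1) (remove_coef t i * q (r - i%:Z)).

(** The inner call lives over [{poly A}], whose indeterminate is the variable removed by the leading
    entry; hence the ring changes along the recursion. *)
Fixpoint jing (A : comNzRingType) (t : A) (q : int -> A) (al : seq int) : A :=
  if al is m :: be then coef_pairing q m (jing t%:P (remove_var t q) be)
  else 1.

(** The sequences [al - 2 e_i] of Euler's identity. *)
Fixpoint lowers (al : seq int) : seq (seq int) :=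
  if al is m :: be then
    (m - 2 :: be) :: [seq m :: ga | ga <- lowers be]
  else [::].

Section Pairing.
Variables (A : comNzRingType) (q : int -> A).

Lemma coef_pairingE n m (f : {poly A}) : (size f <= n)%N ->
  coef_pairing q m f = \sum_(s < n) q (m + s%:Z) * f`_s.
Proof.
move=> le; rewrite /coef_pairing.
rewrite -(big_mkord xpredT (fun s => q (m + s%:Z) * f`_s)).
rewrite -(big_mkord xpredT (fun s : nat => q (m + s%:Z) * f`_s)).
rewrite [RHS](big_cat_nat (leq0n _) le) //= [X in _ + X]big1_seq ?addr0 // => s.
by rewrite mem_index_iota => /= /andP[le_s _]; rewrite nth_default ?mulr0.
Qed.

Lemma coef_pairing_additive m f g :
  coef_pairing q m (f + g) = coef_pairing q m f + coef_pairing q m g.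
Proof.
pose n := maxn (size (f + g)) (maxn (size f) (size g)).
rewrite !(@coef_pairingE n) /n ?leq_max ?leqnn ?orbT // -big_split /=.
by apply: eq_bigr => s _; rewrite coefD mulrDr.
Qed.

Lemma coef_pairingZ m a f :
  coef_pairing q m (a%:P * f) = a * coef_pairing q m f.
Proof.
pose n := maxn (size (a%:P * f)) (size f).
rewrite !(@coef_pairingE n) /n ?leq_max ?leqnn ?orbT // mulr_sumr.
by apply: eq_bigr => s _; rewrite coefCM mulrCA.
Qed.

Lemma coef_pairing0 m : coef_pairing q m 0 = 0.
Proof. by rewrite /coef_pairing size_poly0 big_ord0. Qed.

Lemma coef_pairingB m f g :
  coef_pairing q m (f - g) = coef_pairing q m f - coef_pairing q m g.
Proof.
by rewrite -[- g]mulN1r -polyCN coef_pairing_additive coef_pairingZ mulN1r.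
Qed.

Lemma coef_pairing1 m : coef_pairing q m 1 = q m.
Proof. by rewrite (@coef_pairingE 1) ?size_poly1 // big_ord1 coef1 mulr1 addr0. Qed.

Lemma coef_pairingX m f : coef_pairing q m ('X * f) = coef_pairing q (m + 1) f.
Proof.
rewrite (@coef_pairingE (size f).+1); last first.
  by apply: leq_trans (size_polyMleq _ _) _; rewrite size_polyX.
rewrite big_ord_recl coefXM mulr0 add0r; apply: eq_bigr => s _.
by rewrite coefXM /= /bump leq0n add1n; congr (q _ * _); lia.
Qed.

Lemma coef_pairing_sum m (I : Type) (r : seq I) (F : I -> {poly A}) :
  coef_pairing q m (\sum_(i <- r) F i) = \sum_(i <- r) coef_pairing q m (F i).
Proof.
elim: r => [|i r IH]; first by rewrite !big_nil coef_pairing0.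
by rewrite !big_cons coef_pairing_additive IH.
Qed.

End Pairing.

Section RemoveVar.
Variables (A : comNzRingType) (t : A) (q : int -> A).
Hypothesis q_neg : forall r, r < 0 -> q r = 0.

Lemma coef_remove_var r i :
  (remove_var t q r)`_i = remove_coef t i * q (r - i%:Z).
Proof.
rewrite coef_poly; case: ltnP => // le; rewrite q_neg ?mulr0 //.
lia.
Qed.

Lemma remove_var_neg r : r < 0 -> remove_var t q r = 0.
Proof.
move=> r0; apply/polyP => i; rewrite coef_remove_var coef0 q_neg ?mulr0 //.
lia.
Qed.

Lemma remove_var0 : remove_var t q 0 = (q 0)%:P.
Proof.
apply/polyP => i; rewrite coef_remove_var coefC; case: i => [|i] /=.
  by rewrite mul1r subr0.
by rewrite q_neg ?mulr0.
Qed.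

(* Comparison of coefficients in (1 - t z) F(z) = 1 - z. *)
Lemma remove_varE r :
  remove_var t q r =
  t%:P * ('X * remove_var t q (r - 1)) + (q r)%:P - 'X * (q (r - 1))%:P.
Proof.
apply/polyP => i; rewrite coefB coefD coefCM !coefXM !coefC !coef_remove_var.
case: i => [|[|i]] /=.
- by rewrite subr0; ring.
- by rewrite subr0; ring.
rewrite (_ : r - i.+2%:Z = r - 1 - i.+1%:Z); last by lia.
by rewrite exprS; ring.
Qed.

End RemoveVar.

Lemma remove_coef_map (A B : comNzRingType) (phi : {rmorphism A -> B}) t i :
  phi (remove_coef t i) = remove_coef (phi t) i.
Proof. by case: i => [|i] /=; rewrite ?rmorph1 // rmorphM rmorphXn rmorphB rmorph1. Qed.

Lemma jing_ext (A : comNzRingType) (t : A) q1 q2 al :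
  q1 =1 q2 -> jing t q1 al = jing t q2 al.
Proof.
elim: al A t q1 q2 => [//|m be IH] A t q1 q2 eq_q /=.
rewrite (IH _ _ (remove_var t q1) (remove_var t q2)) => [|r].
  by apply: eq_bigr => s _; rewrite eq_q.
by apply/polyP => i; rewrite !coef_poly eq_q.
Qed.

Lemma coef_pairing_rmorph (A B : comNzRingType) (phi : {rmorphism A -> B}) q m f :
  phi (coef_pairing q m f) = coef_pairing (phi \o q) m (map_poly phi f).
Proof.
rewrite [RHS](@coef_pairingE _ _ (size f)) ?size_poly // rmorph_sum /=.
by apply: eq_bigr => s _; rewrite rmorphM coef_map.
Qed.

Lemma remove_var_rmorph (A B : comNzRingType) (phi : {rmorphism A -> B}) t q r :
  map_poly phi (remove_var t q r) = remove_var (phi t) (phi \o q) r.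
Proof.
apply/polyP => i; rewrite coef_map /= !coef_poly; case: ifP => _; last exact: rmorph0.
by rewrite /= rmorphM remove_coef_map.
Qed.

Lemma jing_rmorph (A B : comNzRingType) (phi : {rmorphism A -> B}) t q al :
  phi (jing t q al) = jing (phi t) (phi \o q) al.
Proof.
elim: al A B phi t q => [|m be IH] A B phi t q /=; first exact: rmorph1.
rewrite coef_pairing_rmorph IH /= map_polyC; congr (coef_pairing _ _ _).
by apply: jing_ext => r; apply: remove_var_rmorph.
Qed.

(** The innermost pairing is with the constant 1, so the last entry contributes a bare coefficient
    of negative index. *)
Lemma jing_cat_neg (A : comNzRingType) (t : A) q al m :
  (forall r, r < 0 -> q r = 0) -> m < 0 -> jing t q (rcons al m) = 0.
Proof.
move=> + m0; elim: al A t q => [|n be IH] A t q q_neg /=.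
  by rewrite coef_pairing1 q_neg.
by rewrite IH ?coef_pairing0 // => r; apply: remove_var_neg.
Qed.

Lemma jing_rcons0 (A : comNzRingType) (t : A) q al :
  (forall r, r < 0 -> q r = 0) -> q 0 = 1 -> jing t q (rcons al 0) = jing t q al.
Proof.
elim: al A t q => [|n be IH] A t q q_neg q0 /=; first by rewrite coef_pairing1.
rewrite IH // => [r|]; first exact: remove_var_neg.
by rewrite remove_var0 // q0.
Qed.

(** * Straightening of two adjacent entries *)

Section Straightening.
Variables (A : comNzRingType) (t : A) (q : int -> A) (be : seq int).
Hypothesis q_neg : forall r, r < 0 -> q r = 0.

(** [H] is the value of [be] in the two variables removed by the leading entries; [S] pairs both
    variables with [q] itself, without the interaction that [remove_var] puts between the two
    entries. *)
Let H := jing t%:P%:P (remove_var t%:P (remove_var t q)) be.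
Let S r s := coef_pairing q r (coef_pairing (polyC \o q) s H).

(** The two removals commute: the coefficients of the double removal are [remove_coef t i *
    remove_coef t j * q (r - i - j)]. *)
Let swapXY_H : swapXY H = H.
Proof.
rewrite /H [LHS](jing_rmorph (@swapXY A : {rmorphism _ -> _})) /=.
rewrite swapXY_polyC map_polyC.
apply: jing_ext => r; apply/polyP => i; apply/polyP => j /=.
have nn := remove_var_neg t q_neg.
rewrite coef_swapXY !(coef_remove_var _ nn).
by rewrite -!(remove_coef_map polyC) !coefCM !coef_remove_var // addrAC; ring.
Qed.

Let H_sym i j : H`_i`_j = H`_j`_i.
Proof. by rewrite -{1}swapXY_H coef_swapXY. Qed.

Let SE n r s : (sizeY H <= n)%N -> (size H <= n)%N ->
  S r s = \sum_(b < n) \sum_(c < n) q (r + b%:Z) * (q (s + c%:Z) * H`_c`_b).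
Proof.
move=> leY leX; rewrite /S (coef_pairingE _ _ leX) coef_pairing_sum exchange_big.
apply: eq_bigr => c _ /=; rewrite coef_pairingZ (@coef_pairingE _ _ n).
  by rewrite mulr_sumr; apply: eq_bigr => b _; rewrite mulrCA.
exact: leq_trans (max_size_coefXY _ _) leY.
Qed.

Let S_sym r s : S r s = S s r.
Proof.
pose n := maxn (sizeY H) (size H).
rewrite !(@SE n) /n ?leq_maxl ?leq_maxr // exchange_big /=.
apply: eq_bigr => b _; apply: eq_bigr => c _.
by rewrite H_sym mulrCA.
Qed.

(** [remove_varE] is applied in the inner pairing; each factor ['X] there raises the index of the
    outer one. *)
Let T_rec r s :
  jing t q [:: r, s & be] =
  t * jing t q [:: r + 1, s - 1 & be] + S r s - S (r + 1) (s - 1).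
Proof.
rewrite /= -/H.
have -> : coef_pairing (remove_var t q) s H =
    t%:P * ('X * coef_pairing (remove_var t q) (s - 1) H)
    + coef_pairing (polyC \o q) s H
    - 'X * coef_pairing (polyC \o q) (s - 1) H.
  rewrite /coef_pairing !mulr_sumr -!big_split -sumrB /=; apply: eq_bigr => c _.
  by rewrite (remove_varE t q_neg) (addrAC s) /=; ring.
by rewrite coef_pairingB coef_pairing_additive coef_pairingZ !coef_pairingX.
Qed.

(** The two [S] terms of [T_rec] cancel by symmetry. *)
Lemma jing_swap1 s :
  jing t q [:: s, s + 1 & be] = t * jing t q [:: s + 1, s & be].
Proof. by rewrite T_rec addrK (S_sym (s + 1)) addrK. Qed.

(** In the sum of [T_rec] at [(s, s + 2)] and at [(s + 1, s + 1)] the [S] terms cancel by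
    symmetry. *)
Lemma jing_swap2 s :
  jing t q [:: s, s + 2 & be] =
  t * jing t q [:: s + 2, s & be] + (t - 1) * jing t q [:: s + 1, s + 1 & be].
Proof.
have e1 := T_rec (s + 1) (s + 1); have e2 := T_rec s (s + 2).
have s2 : s + 2 - 1 = s + 1 by lia.
rewrite addrK (_ : s + 1 + 1 = s + 2) in e1; last by lia.
rewrite s2 in e2; rewrite e2 mulrBl mul1r {3}e1 (S_sym (s + 2)); ring.
Qed.

End Straightening.

Lemma jing_cons_linear (A : comNzRingType) (t : A) q m al be ga (a b : A) :
  (jing t%:P (remove_var t q) al =
   a%:P * jing t%:P (remove_var t q) be + b%:P * jing t%:P (remove_var t q) ga) ->
  jing t q (m :: al) = a * jing t q (m :: be) + b * jing t q (m :: ga).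
Proof. by move=> /= ->; rewrite coef_pairing_additive !coef_pairingZ. Qed.

Lemma jing_swap1_cat (A : comNzRingType) (t : A) q al s be :
  (forall r, r < 0 -> q r = 0) ->
  jing t q (al ++ [:: s, s + 1 & be]) = t * jing t q (al ++ [:: s + 1, s & be]).
Proof.
elim: al A t q => [|m al IH] A t q q_neg; first exact: jing_swap1.
(* The rule has a single term, so the second summand gets coefficient 0 and a dummy sequence. *)
rewrite !cat_cons (@jing_cons_linear _ _ _ _ _ (al ++ [:: s + 1, s & be]) [::] t 0).
  by rewrite mul0r addr0.
by rewrite IH ?mul0r ?addr0 // => r; apply: remove_var_neg.
Qed.

Lemma jing_swap2_cat (A : comNzRingType) (t : A) q al s be :
  (forall r, r < 0 -> q r = 0) ->
  jing t q (al ++ [:: s, s + 2 & be]) =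
  t * jing t q (al ++ [:: s + 2, s & be]) +
  (t - 1) * jing t q (al ++ [:: s + 1, s + 1 & be]).
Proof.
elim: al A t q => [|m al IH] A t q q_neg; first exact: jing_swap2.
rewrite !cat_cons; apply: jing_cons_linear.
by rewrite IH ?polyCB // => r; apply: remove_var_neg.
Qed.

(** * Derivations and Euler's identity *)

Section Derivation.

Definition is_derivation (A : comNzRingType) (d : A -> A) :=
  {morph d : a b / a + b} /\ (forall a b, d (a * b) = d a * b + a * d b).

(** The operator [d + X d/dX], which gives the removed variable degree 1. With it, the condition on
    [q] in [derivation_jing] is inherited by [remove_var t q]. *)
Definition poly_derivation (A : comNzRingType) (d : A -> A) (f : {poly A}) :
    {poly A} :=
  \poly_(i < size f) (d f`_i + f`_i *+ i).

Variables (A : comNzRingType) (d : A -> A).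
Hypothesis d_der : is_derivation d.

Lemma derivation0 : d 0 = 0.
Proof. by apply: (addrI (d 0)); rewrite -d_der.1 !addr0. Qed.

Lemma derivation1 : d 1 = 0.
Proof.
by apply: (addrI (d 1)); rewrite addr0 -{3}[1]mulr1 d_der.2 mulr1 mul1r.
Qed.

Lemma derivation_sum (I : Type) (r : seq I) (F : I -> A) :
  d (\sum_(i <- r) F i) = \sum_(i <- r) d (F i).
Proof. by rewrite (big_morph d d_der.1 derivation0). Qed.

Lemma coef_poly_derivation f i : (poly_derivation d f)`_i = d f`_i + f`_i *+ i.
Proof.
rewrite coef_poly; case: ltnP => // le; rewrite nth_default //.
by rewrite derivation0 mul0rn addr0.
Qed.

Lemma poly_derivation_derivation : is_derivation (poly_derivation d).
Proof.
split=> f g; apply/polyP => i.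
  by rewrite coefD !coef_poly_derivation coefD d_der.1 mulrnDl addrACA.
rewrite coefD !coef_poly_derivation !coefM derivation_sum -sumrMnl -!big_split /=.
apply: eq_bigr => j _; rewrite d_der.2 !coef_poly_derivation.
have -> : f`_j * g`_(i - j) *+ i =
    f`_j * g`_(i - j) *+ j + f`_j * g`_(i - j) *+ (i - j).
  by rewrite -mulrnDr subnKC // -ltnS.
by rewrite mulrDl mulrDr mulrnAl mulrnAr; ring.
Qed.

Lemma derivation_remove_coef t i : d t = 0 -> d (remove_coef t i) = 0.
Proof.
move=> dt0; case: i => [|i] /=; first exact: derivation1.
have dX : d (t ^+ i) = 0.
  elim: i => [|i IH]; first exact: derivation1.
  by rewrite exprS d_der.2 dt0 IH mulr0 mul0r addr0.
have dN : d (t - 1) = 0.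
  have := d_der.1 (t - 1) 1; rewrite subrK dt0 derivation1 addr0 => <- //.
by rewrite d_der.2 dX dN mulr0 mul0r addr0.
Qed.

End Derivation.

(** Apply the product rule to the terms [q (m + s) * f_s]. Of the factor [m + s], the part [s] is
    absorbed by [poly_derivation d f], to which induction applies; the terms [q (m + s - 2)] lower
    the leading entry. *)
Lemma derivation_jing (A : comNzRingType) (d : A -> A) t c q al :
  is_derivation d -> d t = 0 -> (forall r, r < 0 -> q r = 0) ->
  (forall r, d (q r) = r%:~R * q r - c * q (r - 2)) ->
  d (jing t q al) =
  (\sum_(m <- al) m)%:~R * jing t q al - c * \sum_(be <- lowers al) jing t q be.
Proof.
elim: al A d t c q => [|m al IH] A d t c q d_der dt q_neg dq.
  by rewrite /= !big_nil mulr0 subr0 mul0r derivation1.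
set q' := remove_var t q.
have q'_neg r : r < 0 -> q' r = 0 by apply: remove_var_neg.
have dq' r : poly_derivation d (q' r) = r%:~R * q' r - c%:P * q' (r - 2).
  apply/polyP => i; rewrite coef_poly_derivation // coefB coefCM.
  rewrite -(rmorph_int polyC) coefCM !coef_remove_var // d_der.2 dq.
  rewrite (derivation_remove_coef d_der i dt).
  rewrite mul0r add0r (addrAC r). rewrite intrB -mulr_natl.
  by rewrite -[i%:~R]/(i%:R); ring.
rewrite big_cons /= big_cons big_map -/q'.
have dt' : poly_derivation d t%:P = 0.
  apply/polyP => i; rewrite coef_poly_derivation // coefC coef0.
  case: i => [|i] /=; first by rewrite dt mulr0n addr0.
  by rewrite (derivation0 d_der) mul0rn addr0.
have := IH _ _ _ c%:P q' (poly_derivation_derivation d_der) dt' q'_neg dq'.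
set f := jing _ _ al => df.
have df_pair : coef_pairing q m (poly_derivation d f) =
    (\sum_(j <- al) j)%:~R * coef_pairing q m f
    - c * \sum_(be <- lowers al) coef_pairing q m (jing t%:P q' be).
  rewrite df -(rmorph_int polyC) coef_pairingB !coef_pairingZ.
  by rewrite coef_pairing_sum.
rewrite intrD mulrDl mulrDr opprD addrACA -df_pair.
rewrite (@coef_pairingE _ q (size f) m (poly_derivation d f)) ?size_poly //.
rewrite /coef_pairing derivation_sum // !mulr_sumr -sumrB -big_split /=.
apply: eq_bigr => s _; rewrite d_der.2 dq coef_poly_derivation // intrD.
by rewrite (addrAC m) -mulr_natl -[s%:~R]/(s%:R); ring.
Qed.

(** * Newton recursion and power sums of finitely many points *)

Definition extend0 (A : comNzRingType) (q : nat -> A) (r : int) : A :=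
  if r is Posz n then q n else 0.

Lemma extend0_neg (A : comNzRingType) (q : nat -> A) r : r < 0 -> extend0 q r = 0.
Proof. by case: r. Qed.

(* The recursion satisfied by the coefficients q_r of
   exp (sum_k (1 - t^k) p_k u^k / k). *)
Definition newton (A : comNzRingType) (t : A) (p q : nat -> A) :=
  q 0%N = 1 /\ forall r, q r.+1 *+ r.+1 =
    \sum_(k < r.+1) (1 - t ^+ k.+1) * p k.+1 * q (r - k)%N.

Lemma newton_rmorph (A B : comNzRingType) (phi : {rmorphism A -> B}) t p q :
  newton t p q -> newton (phi t) (phi \o p) (phi \o q).
Proof.
move=> [q0 qS]; split=> [|r] /=; first by rewrite q0 rmorph1.
rewrite -rmorphMn qS rmorph_sum; apply: eq_bigr => k _.
by rewrite !rmorphM rmorphB rmorphXn rmorph1.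
Qed.

Lemma newton_ext (A : comNzRingType) (t : A) p p' q :
  (forall k, p k.+1 = p' k.+1) -> newton t p q -> newton t p' q.
Proof.
move=> eq_p [q0 qS]; split=> // r; rewrite qS.
by apply: eq_bigr => k _; rewrite eq_p.
Qed.

Section NewtonExists.
Variables (K : fieldType) (A : comNzRingType) (iota : {rmorphism K -> A}).
Variables (t : A) (p : nat -> A).

(** All earlier values are kept, since each new one depends on all of them; [iota] supplies the
    inverses of integers in [A]. *)
Fixpoint newton_seq (n : nat) : seq A :=
  if n is r.+1 then
    let s := newton_seq r in
    rcons s (iota r.+1%:R^-1 *
      \sum_(k < r.+1) (1 - t ^+ k.+1) * p k.+1 * s`_(r - k))
  else [:: 1].

Lemma size_newton_seq n : size (newton_seq n) = n.+1.
Proof. by elim: n => //= n IH; rewrite size_rcons IH. Qed.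

Lemma nth_newton_seq n r : (r <= n)%N -> (newton_seq n)`_r = (newton_seq r)`_r.
Proof.
elim: n => [|n IH]; first by case: r.
rewrite leq_eqVlt => /orP[/eqP -> //|]; rewrite ltnS => le.
by rewrite /= nth_rcons size_newton_seq ltnS le IH.
Qed.

Lemma newton_exists : (forall n, n.+1%:R != 0 :> K) -> exists q, newton t p q.
Proof.
move=> char0; exists (fun r => (newton_seq r)`_r); split=> // r.
rewrite [newton_seq r.+1]/= nth_rcons size_newton_seq ltnn eqxx.
rewrite -[LHS]mulr_natl mulrA -(rmorph_nat iota) -rmorphM mulfV // rmorph1 mul1r.
by apply: eq_bigr => k _; rewrite nth_newton_seq // leq_subr.
Qed.

End NewtonExists.

Lemma newton_uniq (A : idomainType) (t : A) p q1 q2 :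
  (forall n, n.+1%:R != 0 :> A) -> newton t p q1 -> newton t p q2 -> q1 =1 q2.
Proof.
move=> char0 [q10 q1S] [q20 q2S] r.
elim/ltn_ind: r => -[|r] IH; first by rewrite q10 q20.
apply: (mulfI (char0 r)); rewrite !mulr_natl q1S q2S.
by apply: eq_bigr => k _; rewrite IH // ltnS leq_subr.
Qed.

Section AddVariable.
Variables (A : comNzRingType) (t y : A).

(** The coefficients of [(1 - t y u) / (1 - y u) Q(u)], the inverse of the removal of [y]. *)
Fixpoint add_var (q : nat -> A) (r : nat) : A :=
  if r is s.+1 then y * add_var q s + q s.+1 - t * y * q s else q 0%N.

(** The coefficients of [(1 - z u) Q(u)]. *)
Definition backward_diff z (q : nat -> A) (r : nat) : A :=
  if r is s.+1 then q s.+1 - z * q s else q 0%N.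

Lemma backward_diff_add_var q : backward_diff y (add_var q) =1 backward_diff (t * y) q.
Proof. by case=> //= r; ring. Qed.

Lemma sum_backward_diff (a q : nat -> A) z r :
  \sum_(k < r.+2) a k * q (r.+1 - k)%N =
  z * (\sum_(k < r.+1) a k * q (r - k)%N) +
  \sum_(k < r.+2) a k * backward_diff z q (r.+1 - k)%N.
Proof.
rewrite big_ord_recr [X in _ = _ + X]big_ord_recr /= subnn addrA; congr (_ + _).
rewrite mulr_sumr -big_split /=; apply: eq_bigr => k _.
by rewrite subSn ?ltnS //=; [ring | rewrite -ltnS].
Qed.

Lemma backward_diff_telescope (q : nat -> A) z r :
  \sum_(k < r.+1) z ^+ k.+1 * backward_diff z q (r - k)%N = z * q r.
Proof.
elim: r => [|r IH]; first by rewrite big_ord1.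
rewrite big_ord_recl subn0 /= (_ : \sum_(i < _) _ = z * (z * q r)); first by ring.
by rewrite -IH mulr_sumr; apply: eq_bigr => k _; rewrite mulrA -exprS.
Qed.

Lemma newton_add_var p q :
  newton t p q -> newton t (fun k => p k + y ^+ k) (add_var q).
Proof.
move=> [q0 qS]; split=> // r; elim: r => [|r IH].
  have := qS 0%N; rewrite !big_ord1 /= q0 !mulr1n => ->; ring.
pose c k : A := 1 - t ^+ k.+1.
rewrite (sum_backward_diff (fun k => c k * (p k.+1 + y ^+ k.+1)) _ y) -IH.
under [X in _ + X]eq_bigr => k _ do
  rewrite backward_diff_add_var mulrDr mulrDl.
rewrite big_split /=.
(* Here [c k * y^(k+1)] is [y^(k+1) - (t y)^(k+1)], and each half telescopes, the first one with the
   difference read as that of [add_var q]. *)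
have -> : \sum_(k < r.+2) c k * y ^+ k.+1 * backward_diff (t * y) q (r.+1 - k) =
    y * add_var q r.+1 - t * y * q r.+1.
  rewrite -(backward_diff_telescope _ y) -(backward_diff_telescope _ (t * y)).
  rewrite -sumrB; apply: eq_bigr => k _.
  by rewrite backward_diff_add_var exprMn /c; ring.
have -> : \sum_(k < r.+2) c k * p k.+1 * backward_diff (t * y) q (r.+1 - k) =
    q r.+2 *+ r.+2 - t * y * (q r.+1 *+ r.+1).
  rewrite !qS (sum_backward_diff (fun k => c k * p k.+1) q (t * y) r).
  by rewrite addrAC subrr add0r.
by rewrite /= !mulrS; ring.
Qed.

End AddVariable.

Section Points.
Variables (K : fieldType) (t : K).
Hypothesis char0 : forall n, n.+1%:R != 0 :> K.

Definition power_sum (N : nat) (x : 'I_N -> K) (k : nat) : K :=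
  \sum_(i < N) x i ^+ k.

Definition drop_point (N : nat) (x : 'I_N.+1 -> K) (k : 'I_N.+1) (i : 'I_N) : K :=
  x (lift k i).

Definition cross_factor (N : nat) (x : 'I_N -> K) (k : 'I_N) : K :=
  \prod_(j < N | j != k) ((x k - t * x j) / (x k - x j)).

Lemma drop_point_inj N (x : 'I_N.+1 -> K) k :
  injective x -> injective (drop_point x k).
Proof. by move=> x_inj i j /x_inj /lift_inj. Qed.

Lemma newton_power_sum_exists N (x : 'I_N -> K) :
  exists q, newton t (power_sum x) q.
Proof. exact: (newton_exists (idfun : {rmorphism K -> K})). Qed.

Lemma newton_drop_point N (x : 'I_N.+1 -> K) k q q' :
  newton t (power_sum x) q -> newton t (power_sum (drop_point x k)) q' ->
  q =1 add_var t (x k) q'.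
Proof.
move=> nq nq'; apply: (newton_uniq char0 nq).
have [a0 aS] := newton_add_var (x k) nq'; split=> // r.
rewrite aS; apply: eq_bigr => j _; congr (_ * _ * _).
by rewrite /power_sum (bigD1_ord k) //= addrC.
Qed.

Lemma cross_factor_lift N (x : 'I_N.+1 -> K) k i :
  cross_factor x (lift k i) =
  (x (lift k i) - t * x k) / (x (lift k i) - x k) *
  cross_factor (drop_point x k) i.
Proof.
rewrite /cross_factor (bigD1_ord k) ?neq_lift //=; congr (_ * _).
by apply: eq_bigl => j; rewrite (inj_eq lift_inj).
Qed.

(* The difference eps r of both sides satisfies eps r.+1 = x_k * eps r for every
   k, hence vanishes as soon as there are two different points. *)
Lemma sum_cross_factor N (x : 'I_N -> K) q r :
  injective x -> newton t (power_sum x) q ->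
  (1 - t) * (\sum_(k < N) x k ^+ r * cross_factor x k) =
  q r - (r == 0%N)%:R * t ^+ N.
Proof.
elim: N x q r => [|N IH] x q r x_inj nq.
  rewrite big_ord0 mulr0 expr0 mulr1; case: r => [|r]; first by rewrite nq.1 subrr.
  rewrite /= mulr0n subr0; apply/esym/(mulfI (char0 r)); rewrite mulr_natl nq.2 mulr0.
  by rewrite big1 // => k _; rewrite /power_sum big_ord0 mulr0 mul0r.
pose eps r := (1 - t) * (\sum_(k < N.+1) x k ^+ r * cross_factor x k) -
  (q r - (r == 0%N)%:R * t ^+ N.+1).
have epsS k s : eps s.+1 = x k * eps s.
  have [q' nq'] := newton_power_sum_exists (drop_point x k).
  have qE := newton_drop_point nq nq'.
  have IHk j := IH _ _ j (drop_point_inj x_inj) nq'.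
  have xk_neq i : x (lift k i) - x k != 0.
    by rewrite subr_eq0 (inj_eq x_inj) eq_sym neq_lift.
  (* The factor [x j - x k] kills the term [j = k] and cancels the denominators at [k] in the
     others, which leaves sums over the points other than [x k]. *)
  have step : (\sum_(j < N.+1) x j ^+ s.+1 * cross_factor x j)
      - x k * (\sum_(j < N.+1) x j ^+ s * cross_factor x j) =
      (\sum_(j < N) drop_point x k j ^+ s.+1 * cross_factor (drop_point x k) j)
      - t * x k * (\sum_(j < N) drop_point x k j ^+ s * cross_factor (drop_point x k) j).
    rewrite !mulr_sumr -!sumrB (bigD1_ord k) //= exprS mulrA subrr add0r.
    apply: eq_bigr => i _; rewrite cross_factor_lift /drop_point.
    move: (xk_neq i) (cross_factor _ i); rewrite exprS.
    move: (x (lift k i)) (x k) => a b ab C.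
    by field.
  move/(congr1 ( *%R (1 - t))): step; rewrite !mulrBr !(mulrCA (1 - t)) !IHk.
  move/eqP; rewrite subr_eq /eps => /eqP ->.
  rewrite !qE; case: s => [|s] /=; last by ring.
  by rewrite exprS; ring.
apply/eqP; rewrite -subr_eq0 -/(eps r); apply/eqP.
suff eps0 : eps 0%N = 0.
  by elim: r => [//|r IHr]; rewrite (epsS ord0) IHr mulr0.
case: N IH x x_inj q nq @eps epsS => [|N] _ x x_inj q nq eps epsS.
  rewrite /eps big_ord1 /cross_factor big_pred0 => [|j]; last by rewrite !ord1.
  by rewrite nq.1 /=; ring.
have /eqP := epsS ord0 0%N; rewrite (epsS ord_max) -subr_eq0 -mulrBl mulf_eq0.
by rewrite subr_eq0 (inj_eq x_inj) => /orP[/eqP/(congr1 val) //|/eqP].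
Qed.

End Points.

(** * Symmetrization as a product of Jing's operators *)

(** The inverse deletes position 0 and its value [k]; this reindexes the permutations with a given
    first image. *)
Lemma lift_perm_bij (N : nat) (k : 'I_N.+1) :
  {on [pred w : 'S_N.+1 | w ord0 == k], bijective (lift_perm ord0 k)}.
Proof.
pose g (w : 'S_N.+1) (i : 'I_N) := odflt i (unlift k (w (lift ord0 i))).
have gE (w : 'S_N.+1) i : w ord0 == k -> lift k (g w i) = w (lift ord0 i).
  move=> /eqP wk; rewrite /g; case: unliftP => [j -> //|] /=.
  by rewrite -wk => /perm_inj/eqP; rewrite eq_sym eq_liftF.
have g_inj (w : 'S_N.+1) : w ord0 == k -> injective (g w).
  by move=> wk i j /(congr1 (lift k)); rewrite !gE // => /perm_inj/lift_inj.
exists (fun w => odflt 1%g [pick s | lift_perm ord0 k s == w]) => [s _|w wk].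
  case: pickP => [s' /eqP/permP e|/(_ s)/eqP //].
  apply/permP => i; apply: (@lift_inj _ k).
  by have := e (lift ord0 i); rewrite !lift_perm_lift.
case: pickP => [s /eqP //|/(_ (perm (g_inj w wk)))/eqP[]].
apply/permP => i; case: (unliftP ord0 i) => [j|] ->.
  by rewrite lift_perm_lift permE gE.
by rewrite lift_perm_id (eqP wk).
Qed.

Section HLSum.
Variables (K : fieldType) (t : K).
Hypothesis char0 : forall n, n.+1%:R != 0 :> K.

(** The permutations are grouped by the image [k] of position 0, whose factors form
    [cross_factor]. *)
Lemma HL_sum_rec N (x : 'I_N.+1 -> K) la :
  HL_sum t x la = \sum_(k < N.+1) x k ^+ nth 0%N la 0 * cross_factor t x k *
    HL_sum t (drop_point x k) (behead la).
Proof.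
rewrite /HL_sum (partition_big (fun w : 'S_N.+1 => w ord0) xpredT) //=.
apply: eq_bigr => k _; rewrite (reindex _ (lift_perm_bij k)) mulr_sumr /=.
apply: eq_big => [s|s _]; first by rewrite lift_perm_id eqxx.
rewrite !big_ord_recl lift_perm_id /= -!mulrA; congr (_ * _).
rewrite mulrCA [X in X * _ = _]big_mkcond big_ord_recl /= mul1r; congr (_ * _).
  rewrite /cross_factor [RHS]big_mkcond [RHS](bigD1_ord k) //= eqxx mul1r.
  rewrite [RHS](reindex_inj (@perm_inj _ s)) /=.
  by apply: eq_bigr => i _; rewrite lift_perm_lift eq_sym neq_lift.
congr (_ * _).
  by apply: eq_bigr => i _; rewrite lift_perm_lift nth_behead.
apply: eq_bigr => i _; rewrite [LHS]big_mkcond big_ord_recl /= mul1r [RHS]big_mkcond /=.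
by apply: eq_bigr => j _; rewrite !lift_perm_lift.
Qed.

(** The [t]-factorial of [N]. *)
Definition qint (N : nat) : K := \prod_(1 <= j < N.+1) ((1 - t ^+ j) / (1 - t)).

Hypothesis t_neq1 : 1 - t != 0.

Lemma HL_sum_nil N (x : 'I_N -> K) : injective x -> HL_sum t x [::] = qint N.
Proof.
elim: N x => [|N IH] x x_inj.
  rewrite /qint big_geq // /HL_sum (big_pred1 1%g) ?big_ord0 ?mul1r // => s.
  by apply/esym/eqP/permP; case.
have [q nq] := newton_power_sum_exists t char0 x.
rewrite HL_sum_rec; under eq_bigr => k _.
  rewrite (IH _ (drop_point_inj x_inj)); over.
rewrite -mulr_suml /qint [RHS]big_nat_recr //= [RHS]mulrC; congr (_ * _).
apply: (mulfI t_neq1); rewrite (sum_cross_factor char0 0 x_inj nq) nq.1 mul1r.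
by rewrite mulrCA mulfV // mulr1.
Qed.

(** Evaluation of the removed variable at [x k] undoes [add_var t (x k)]: both sides satisfy the
    same recursion in [r]. *)
Lemma remove_var_drop_point N (x : 'I_N.+1 -> K) k q q' r :
  newton t (power_sum x) q -> newton t (power_sum (drop_point x k)) q' ->
  (remove_var t (extend0 q) r).[x k] = extend0 q' r.
Proof.
move=> nq nq'; have qE := newton_drop_point char0 nq nq'.
case: r => [r|r]; last by rewrite remove_var_neg ?horner0 // => s; apply: extend0_neg.
elim: r => [|r IH].
  by rewrite remove_var0 ?hornerC /= ?qE // => s; apply: extend0_neg.
rewrite remove_varE; last by move=> s; apply: extend0_neg.
have -> : r.+1%:Z - 1 = r%:Z by lia.
by rewrite !hornerE IH /= !qE /=; ring.
Qed.

(** The polynomial [f] of the tail takes at [x k] the value belonging to the remaining points, and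
    [sum_cross_factor] turns the sum over [k] of [x k ^ (m + s)] times [cross_factor] into
    [q (m + s)]. Each part costs a factor [1 - t]. *)
Lemma jing_HL_sum N (x : 'I_N -> K) q (la : seq nat) :
  injective x -> newton t (power_sum x) q -> 0%N \notin la -> (size la <= N)%N ->
  (1 - t) ^+ size la * HL_sum t x la =
  jing t (extend0 q) (map Posz la) * qint (N - size la).
Proof.
elim: la N x q => [|m la IH] N x q x_inj nq.
  by move=> _ _; rewrite mul1r HL_sum_nil // subn0 mul1r.
rewrite inE negb_or eq_sym => /andP[m0 la0]; case: N x x_inj nq => // N x x_inj nq le.
rewrite HL_sum_rec /= subSS; set f := jing _ _ _.
have fx k : f.[x k] * qint (N - size la) =
    (1 - t) ^+ size la * HL_sum t (drop_point x k) la.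
  have [q' nq'] := newton_power_sum_exists t char0 (drop_point x k).
  rewrite (IH _ _ _ (drop_point_inj x_inj) nq' la0 le); congr (_ * _).
  rewrite /f -[LHS]/(horner_eval (x k) _) jing_rmorph /= /horner_eval hornerC.
  by apply: jing_ext => r /=; apply: remove_var_drop_point nq nq'.
transitivity (\sum_(k < N.+1) (1 - t) * (x k ^+ m * cross_factor t x k) * f.[x k]
   * qint (N - size la)).
  rewrite mulr_sumr; apply: eq_bigr => k _.
  by rewrite -[RHS]mulrA fx exprS; ring.
rewrite -mulr_suml; congr (_ * _).
under eq_bigr => k _ do rewrite horner_coef mulr_sumr.
rewrite exchange_big; apply: eq_bigr => s _ /=.
(* Positivity of [m] excludes the exceptional exponent 0 of [sum_cross_factor]. *)
have qE : q (m + s)%N = (1 - t) * \sum_(k < N.+1) x k ^+ (m + s) * cross_factor t x k.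
  rewrite (sum_cross_factor char0 _ x_inj nq) addn_eq0.
  by rewrite (negbTE m0) mul0r subr0.
rewrite /= qE -mulrA mulr_suml mulr_sumr.
by apply: eq_bigr => k _; rewrite exprD; ring.
Qed.

End HLSum.

(** * Signs of straightened sequences *)

Lemma n_part_cons x s : n_part (x :: s) = (n_part s + sumn s)%N.
Proof.
rewrite /n_part /= big_ord_recl mul0n add0n sumnE (big_nth 0%N) big_mkord.
by rewrite -big_split; apply: eq_bigr => i _; rewrite lift0 mulSn addnC.
Qed.

Lemma n_part_cat s1 s2 :
  n_part (s1 ++ s2) = (n_part s1 + n_part s2 + size s1 * sumn s2)%N.
Proof.
elim: s1 => [|x s IH]; first by rewrite /= /n_part big_ord0 addn0.
by rewrite cat_cons !n_part_cons IH sumn_cat /=; lia.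
Qed.

Lemma geq_trans : transitive geq.
Proof. by move=> y x z xy yz; apply: leq_trans xy. Qed.

Lemma sorted_geq_block v s : sorted geq s -> all (geq v) s ->
  exists m tl, s = nseq m v ++ tl /\ all (gtn v) tl.
Proof.
rewrite (sorted_pairwise geq_trans).
elim: s => [|x s IH]; first by exists 0%N, [::].
move=> /= /andP[xs ss] /andP[vx vs].
have [m [tl [e tlv]]] := IH ss vs.
move: vx; rewrite /= leq_eqVlt => /orP[/eqP xv|xv].
  by exists m.+1, tl; rewrite xv e.
exists 0%N, (x :: s); split=> //=; rewrite xv /=.
by apply/allP => y ys; apply: leq_ltn_trans (allP xs y ys) xv.
Qed.

Lemma lowers_cat s1 s2 : lowers (s1 ++ s2) =
  [seq l ++ s2 | l <- lowers s1] ++ [seq s1 ++ l | l <- lowers s2].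
Proof.
elim: s1 => [|x s IH]; first by rewrite /= map_id.
by rewrite /= IH map_cat -!map_comp.
Qed.

Section Sign.
Variables (R : realFieldType) (t : R) (b : seq int -> R).
Hypothesis t_lt0 : -1 < t < 0.
Hypothesis b_neg : forall al m, m < 0 -> b (rcons al m) = 0.
Hypothesis b_rcons0 : forall al, b (rcons al 0) = b al.
Hypothesis b_swap1 : forall al s be,
  b (al ++ [:: s, s + 1 & be]) = t * b (al ++ [:: s + 1, s & be]).
Hypothesis b_swap2 : forall al s be,
  b (al ++ [:: s, s + 2 & be]) =
  t * b (al ++ [:: s + 2, s & be]) + (t - 1) * b (al ++ [:: s + 1, s + 1 & be]).

Lemma b_move1 al s n be :
  b (al ++ s :: nseq n (s + 1) ++ be) = t ^+ n * b (al ++ nseq n (s + 1) ++ s :: be).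
Proof.
elim: n al => [|n IH] al; first by rewrite mul1r.
rewrite /= b_swap1 -cat_rcons IH cat_rcons exprS mulrA; congr (_ * _).
Qed.

(** Every swap leaves a remainder with two entries [s + 1], which [b_move1] carries past the rest of
    the block. For [n = 0] the second coefficient vanishes, so the truncated [n.-1] is harmless. *)
Lemma b_move2 al s n be :
  b (al ++ s :: nseq n (s + 2) ++ be) =
  t ^+ n * b (al ++ nseq n (s + 2) ++ s :: be)
  - t ^+ n.-1 * (1 - t ^+ n) *
    b (al ++ nseq n.-1 (s + 2) ++ [:: s + 1, s + 1 & be]).
Proof.
elim: n al => [|n IH] al; first by rewrite !mul1r subrr mul0r subr0.
have e : s + 2 = s + 1 + 1 by rewrite -addrA.
rewrite /= b_swap2 -cat_rcons IH cat_rcons.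
have -> : b (al ++ [:: s + 1, s + 1 & nseq n (s + 2) ++ be]) =
    t ^+ n * t ^+ n * b (al ++ nseq n (s + 2) ++ [:: s + 1, s + 1 & be]).
  rewrite e -cat_rcons b_move1 cat_rcons -mulrA; congr (_ * _).
  by rewrite -[_ :: be]cat1s -[RHS]/(_) b_move1.
case: n {IH} => [|n] /=; first by rewrite !expr0 !expr1; ring.
by rewrite cat_rcons !exprS; ring.
Qed.

(** [q1 n] is the [t]-integer of [n], and [q2 n] is [1 - t] times the Gaussian binomial of [n + 1]
    over 2. *)
Let q1 n : R := (1 - t ^+ n) / (1 - t).
Let q2 n : R := (1 - t ^+ n) * (1 - t ^+ n.+1) / (1 - t ^+ 2).

Let t1 : 1 - t != 0.
Proof. by case/andP: t_lt0 => t_gt t_lt; apply: lt0r_neq0; lra. Qed.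

Let tt1 : 0 < 1 - t ^+ 2.
Proof. by case/andP: t_lt0 => t_gt t_lt; nra. Qed.

(** [b_move2] carries each lowered entry to the end of the block; its coefficients [t^i] and
    [t^(i-1) (1 - t^i)] add up to [q1] and [q2]. *)
Lemma b_lowers_block al s n be :
  \sum_(l <- lowers (nseq n.+1 (s + 2))) b (al ++ l ++ be) =
  q1 n.+1 * b (al ++ nseq n (s + 2) ++ s :: be)
  - q2 n * b (al ++ nseq n.-1 (s + 2) ++ [:: s + 1, s + 1 & be]).
Proof.
elim: n al => [|n IH] al.
  by rewrite /= big_seq1 addrK /q1 /q2 expr0 expr1 subrr !mul0r subr0 mulfV ?mul1r.
rewrite -[nseq n.+2 _]/((s + 2) :: nseq n.+1 (s + 2)).
rewrite -[lowers (_ :: nseq n.+1 _)]/((s + 2 - 2 :: nseq n.+1 (s + 2)) ::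
  [seq s + 2 :: l | l <- lowers (nseq n.+1 (s + 2))]) big_cons big_map addrK.
have -> : \sum_(l <- lowers (nseq n.+1 (s + 2))) b (al ++ ((s + 2) :: l) ++ be) =
    \sum_(l <- lowers (nseq n.+1 (s + 2))) b (rcons al (s + 2) ++ l ++ be).
  by apply: eq_bigr => l _; rewrite cat_rcons.
rewrite IH !cat_rcons (cat_cons s) (b_move2 al s n.+1 be).
have -> : q1 n.+2 = t ^+ n.+1 + q1 n.+1.
  by rewrite /q1 !exprS; field.
have -> : q2 n.+1 = t ^+ n * (1 - t ^+ n.+1) + q2 n.
  by rewrite /q2 !exprS; field; rewrite lt0r_neq0.
case: n {IH} => [|n] /=; last by ring.
by rewrite /q2 !expr0 subrr !mul0r; ring.
Qed.

Definition n_sign (la : seq nat) : R := (-1) ^+ n_part la.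

Lemma sorted_replace_suffix (pre s s' : seq nat) :
  sorted geq (pre ++ s) -> sorted geq s' ->
  {in pre, forall x, all (geq x) s -> all (geq x) s'} -> sorted geq (pre ++ s').
Proof.
rewrite !(sorted_pairwise geq_trans) => + srt' le'.
elim: pre le' => [//|x pre IHpre] le' /= /andP[+ srt]; rewrite {}IHpre //; last first.
  by move=> y y_pre; apply: le'; rewrite inE y_pre orbT.
by rewrite !all_cat andbT => /andP[-> /le' ->] //; rewrite inE eqxx.
Qed.

Section Step.
Variable d : nat.
Hypothesis IH : forall mu : seq nat, sorted geq mu -> sumn mu = d ->
  0 <= n_sign mu * b (map Posz mu).

(** The two removed cells lie in adjacent rows, so [n_part] drops by an odd number. *)
Lemma sign_column pre u tl : sorted geq (pre ++ [:: u.+1, u.+1 & tl]) ->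
  all (gtn u.+1) tl -> sumn (pre ++ [:: u.+1, u.+1 & tl]) = d.+2 ->
  n_sign (pre ++ [:: u.+1, u.+1 & tl]) *
    b (map Posz (pre ++ [:: u, u & tl])) <= 0.
Proof.
move=> srt tlu sum_d.
have -> : n_sign (pre ++ [:: u.+1, u.+1 & tl]) = - n_sign (pre ++ [:: u, u & tl]).
  rewrite /n_sign (_ : n_part _ = n_part (pre ++ [:: u, u & tl]) + (size pre).*2.+1)%N.
    by rewrite exprD -[X in _ * X]signr_odd /= odd_double mulrN1.
  by rewrite !n_part_cat !n_part_cons /=; lia.
rewrite mulNr oppr_le0; apply: IH.
  apply: (sorted_replace_suffix srt) => [|x _ /= /and3P[ux _ ->]].
    have := subseq_sorted geq_trans (suffix_subseq pre _) srt.
    rewrite !(sorted_pairwise geq_trans) /= => /and3P[_ _ ->].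
    by rewrite leqnn andbT /= andbb.
  by rewrite andbT andbb ltnW.
by move: sum_d; rewrite !sumn_cat /=; lia.
Qed.

(** Moving [u] past the [k] parts [u + 1] costs [t^k]. The two removed cells then lie [k] rows
    apart, so [n_sign] changes by [(-1)^k], and [(-t)^k] is nonnegative. *)
Lemma sign_row pre u k tl : sorted geq (pre ++ u.+2 :: nseq k u.+1 ++ tl) ->
  all (gtn u.+1) tl -> sumn (pre ++ u.+2 :: nseq k u.+1 ++ tl) = d.+2 ->
  0 <= n_sign (pre ++ u.+2 :: nseq k u.+1 ++ tl) *
    b (map Posz pre ++ u%:Z :: nseq k (u%:Z + 1) ++ map Posz tl).
Proof.
move=> srt tlu sum_d; rewrite b_move1.
have -> : n_sign (pre ++ u.+2 :: nseq k u.+1 ++ tl) =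
    (-1) ^+ k * n_sign (pre ++ nseq k u.+1 ++ u :: tl).
  rewrite /n_sign -exprD.
  rewrite (_ : n_part _ = (size pre).*2 + (k + n_part (pre ++ nseq k u.+1 ++ u :: tl)))%N.
    by rewrite exprD -[X in X * _]signr_odd odd_double mul1r.
  rewrite !(n_part_cat, n_part_cons, sumn_cat, sumn_nseq, size_nseq) /=.
  by rewrite !(n_part_cat, sumn_cat, sumn_nseq, size_nseq) /=; nia.
rewrite mulrACA -exprMn mulN1r mulr_ge0 ?exprn_ge0 ?oppr_ge0 //.
  by case/andP: t_lt0 => _ /ltW.
have -> : map Posz pre ++ nseq k (u%:Z + 1) ++ u%:Z :: map Posz tl =
    map Posz (pre ++ nseq k u.+1 ++ u :: tl).
  by rewrite !map_cat map_nseq -addn1 PoszD.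
apply: IH; last by move: sum_d; rewrite !(sumn_cat, sumn_nseq) /= sumn_cat sumn_nseq; lia.
apply: (sorted_replace_suffix srt) => [|x _ /= /andP[ux]]; last first.
  rewrite !all_cat => /andP[-> /= ->]; rewrite andbT.
  by apply: leq_trans ux; rewrite ltnW.
have := path_sorted (cat_sorted2 srt).2 => srt'.
apply: (sorted_replace_suffix srt') => [|x].
  have := (cat_sorted2 srt').2; rewrite !(sorted_pairwise geq_trans) /= => ->.
  by rewrite andbT.
by rewrite mem_nseq => /andP[_ /eqP ->] /= ->; rewrite leqnSn.
Qed.

Lemma q1_ge0 n : 0 <= q1 n.
Proof.
case/andP: t_lt0 => t_gt t_lt; rewrite divr_ge0 //; last by lra.
have : `|t ^+ n| <= 1 by rewrite normrX exprn_ile1 // ler_norml; lra.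
by rewrite ler_norml; lra.
Qed.

Lemma q2_ge0 n : 0 <= q2 n.
Proof.
have tn m : 0 <= 1 - t ^+ m.
  case/andP: t_lt0 => t_gt t_lt.
  have : `|t ^+ m| <= 1 by rewrite normrX exprn_ile1 // ler_norml; lra.
  by rewrite ler_norml; lra.
by rewrite divr_ge0 ?mulr_ge0 // ltW.
Qed.

Lemma sign_block pre v m tl :
  sorted geq (pre ++ nseq m.+1 v ++ tl) -> all (gtn v) tl ->
  sumn (pre ++ nseq m.+1 v ++ tl) = d.+2 -> (0 < v)%N -> 0%N \notin tl ->
  0 <= n_sign (pre ++ nseq m.+1 v ++ tl) *
    \sum_(l <- lowers (nseq m.+1 v%:Z)) b (map Posz pre ++ l ++ map Posz tl).
Proof.
move=> srt tlv sum_d v0 tl0; set la := pre ++ _.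
have -> : v%:Z = v%:Z - 2 + 2 by lia.
rewrite b_lowers_block mulrBr subr_ge0; apply: (@le_trans _ _ 0).
  rewrite mulrCA; case: m srt sum_d @la => [|m] srt sum_d la.
    by rewrite /q2 expr0 subrr !mul0r.
  apply: mulr_ge0_le0; first exact: q2_ge0.
  case: v v0 srt sum_d tlv @la => // v _ srt sum_d tlv la.
  have laE : la = (pre ++ nseq m v.+1) ++ [:: v.+1, v.+1 & tl].
    by rewrite /la -addn2 nseqD -!catA.
  have mapE : map Posz pre ++ nseq m.+1.-1 (v.+1%:Z - 2 + 2) ++
      [:: v.+1%:Z - 2 + 1, v.+1%:Z - 2 + 1 & map Posz tl] =
      map Posz ((pre ++ nseq m v.+1) ++ [:: v, v & tl]).
    rewrite -catA !map_cat map_nseq /= subrK.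
    by rewrite (_ : v.+1%:Z - 2 + 1 = v) //; lia.
  by rewrite mapE; rewrite laE; apply: sign_column => //; rewrite -laE.
rewrite mulrCA; apply: mulr_ge0; first exact: q1_ge0.
(* For [v = 1] the tail is empty, its entries being positive and below 1; the lowered entry -1 then
   stands last. *)
case: v v0 srt sum_d tlv @la => [//|[|u]] _ srt sum_d tlv la.
  case: tl tl0 tlv {srt sum_d} @la => [|x tl] tl0 tlv la.
    by rewrite [X in b X]catA cats1 b_neg ?mulr0.
  by move: tl0 tlv; rewrite inE /=; case: (x).
(* In front of [tl] the entry [u = v - 2] is out of order only with respect to the parts [u + 1]. *)
have [k [rest [tlE rest_lt]]] : exists k rest,
    tl = nseq k u.+1 ++ rest /\ all (gtn u.+1) rest.
  by apply: sorted_geq_block (cat_sorted2 (cat_sorted2 srt).2).2 tlv.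
have laE : la = (pre ++ nseq m u.+2) ++ u.+2 :: nseq k u.+1 ++ rest.
  by rewrite /la -addn1 nseqD -!catA tlE.
have -> : map Posz pre ++ nseq m (u.+2%:Z - 2 + 2) ++ u.+2%:Z - 2 :: map Posz tl =
    map Posz (pre ++ nseq m u.+2) ++ u%:Z :: nseq k (u%:Z + 1) ++ map Posz rest.
  rewrite tlE !map_cat !map_nseq subrK -catA (_ : u.+2%:Z - 2 = u); last by lia.
  by rewrite (_ : u%:Z + 1 = u.+1) //; lia.
by rewrite laE; apply: sign_row => //; rewrite -laE.
Qed.

(** The blocks of equal parts are treated one by one; those already treated are moved to [pre]. *)
Lemma sign_lowers pre la : sorted geq (pre ++ la) -> sumn (pre ++ la) = d.+2 ->
  0%N \notin la ->
  0 <= n_sign (pre ++ la) *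
    \sum_(l <- lowers (map Posz la)) b (map Posz pre ++ l).
Proof.
have [n] := ubnP (size la); elim: n pre la => // n IHn pre [|v la].
  by rewrite big_nil mulr0.
move=> size_la srt sum_d la0.
have srt' := (cat_sorted2 srt).2.
have [m [tl [laE tl_lt]]] : exists m tl, v :: la = nseq m.+1 v ++ tl /\ all (gtn v) tl.
  have [m [tl [-> tl_lt]]] : exists m tl, la = nseq m v ++ tl /\ all (gtn v) tl.
    apply: sorted_geq_block (path_sorted srt') _.
    by move: srt'; rewrite (sorted_pairwise geq_trans) /= => /andP[].
  by exists m, tl.
move: la0.
rewrite laE in srt sum_d srt' *; rewrite mem_cat negb_or => /andP[v0 tl0].
rewrite map_cat lowers_cat map_nseq big_cat !big_map.
rewrite -[X in 0 <= _ * X]/(_ + _) mulrDr addr_ge0 //.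
  apply: sign_block => //.
  by move: v0; rewrite inE negb_or eq_sym lt0n => /andP[].
under eq_bigr => l _.
  rewrite catA (_ : map Posz pre ++ _ = map Posz (pre ++ nseq m.+1 v)); last first.
    by rewrite map_cat map_nseq.
  over.
rewrite catA; apply: IHn; rewrite -?catA //.
by move: size_la; rewrite laE size_cat size_nseq; lia.
Qed.

End Step.

Variable k : nat.
Hypothesis b_base : forall la, sorted geq la -> 0%N \notin la -> sumn la = k ->
  0 <= n_sign la * b (map Posz la).
Hypothesis k_le1 : (k <= 1)%N.
Hypothesis b_euler : forall al,
  ((\sum_(m <- al) m)%:~R - k%:R) * b al =
  (1 - t ^+ 2) * \sum_(be <- lowers al) b be.

(** Zero entries are allowed because lowering creates them; they are stripped from the end first.
    Otherwise Euler's identity, with [sumn la - k] positive, reduces the sign to smaller sizes. *)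
Theorem sign_positive la : sorted geq la -> odd (sumn la) = odd k ->
  0 <= n_sign la * b (map Posz la).
Proof.
have [n] := ubnP (sumn la); elim: n la => // n IHn.
elim/last_ind => [|la x IHla] le_n srt par.
  by apply: b_base => //; move: par k_le1; case: (k) => [|[]].
have [x0|x_neq0] := eqVneq x 0%N.
  have sumE : sumn la = sumn (rcons la x) by rewrite sumn_rcons x0 addn0.
  rewrite x0 map_rcons b_rcons0 /n_sign -cats1 n_part_cat muln0 addn0.
  rewrite [n_part [:: _]]big_ord1 mul0n addn0; apply: IHla; rewrite ?sumE //.
  by move: srt; rewrite -cats1 => /cat_sorted2[].
set mu := rcons la x in le_n srt par *.
have mu0 : 0%N \notin mu.
  rewrite mem_rcons inE negb_or eq_sym x_neq0 /=.
  move: srt; rewrite /mu (sorted_pairwise geq_trans) -cats1 pairwise_cat allrel1r.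
  by move=> /andP[/allP le_x _]; apply/negP => /le_x; rewrite /= leqNgt lt0n x_neq0.
have [lt_k|lt_k|] := ltngtP (sumn mu) k; last exact: b_base.
  have : (sumn mu < 1)%N by exact: leq_trans lt_k k_le1.
  by rewrite sumn_rcons ltnS leqn0 addn_eq0 (negbTE x_neq0) andbF.
(* Size 1 would force [k = 0], against the parity. *)
have [d sum_d] : exists d, sumn mu = d.+2.
  move: lt_k par; case: (sumn mu) => [//|[|d]]; last by exists d.
  by case: (k).
have pos : 0 < (sumn mu)%:R - k%:R :> R by rewrite subr_gt0 ltr_nat.
have sumE : (\sum_(m <- map Posz mu) m)%:~R = (sumn mu)%:R :> R.
  by rewrite big_map -(big_morph Posz PoszD (erefl _)) -sumnE pmulrn.
rewrite -(pmulr_rge0 _ pos) mulrCA -sumE b_euler mulrCA pmulr_rge0 //.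
apply: (sign_lowers (d := d) _ (pre := [::])) => // nu srt_nu sum_nu.
apply: IHn => //; first by move: le_n; rewrite sum_nu sum_d ltnS => /ltnW.
by rewrite sum_nu -par sum_d /= negbK.
Qed.

End Sign.

(** * The Plancherel homomorphism *)

Section PsumHom.
Variables (R : realType) (A : comNzRingType) (iota : {rmorphism R -> A}).
Variable p : nat -> A.

Definition psum_hom_mon (m : {cmonom nat}) : A :=
  \prod_(i <- finsupp m) p i.+1 ^+ m i.

Lemma psum_hom_monE (d : {fset nat}) (m : {cmonom nat}) :
  (finsupp m `<=` d)%fset -> psum_hom_mon m = \prod_(i <- d) p i.+1 ^+ m i.
Proof.
move=> le; rewrite /psum_hom_mon (big_fset_incl _ le) //= => i _.
by rewrite -cmE_eq0 => /eqP ->; rewrite expr0.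
Qed.

Lemma psum_hom_mon_mmorphism : monalg.mmorphism psum_hom_mon.
Proof.
split=> [m1 m2|]; last by rewrite /psum_hom_mon mdom1 big_seq_fset0.
rewrite !(@psum_hom_monE (finsupp m1 `|` finsupp m2)%fset) ?mdomD ?fsubsetUl
  ?fsubsetUr ?fsubset_refl //.
by rewrite -big_split /=; apply: eq_bigr => i _; rewrite cmM exprD.
Qed.

HB.instance Definition _ :=
  monalg.isMultiplicative.Build {cmonom nat} A psum_hom_mon psum_hom_mon_mmorphism.

Definition psum_hom : {rmorphism Sym R -> A} := monalg.mmap iota psum_hom_mon.

Lemma psum_homE F : psum_hom F =
  \sum_(m <- monalg.msupp F) iota (monalg.mcoeff m F) * psum_hom_mon m.
Proof. by []. Qed.

Lemma psum_hom_psum k : (0 < k)%N -> psum_hom (psum R k) = p k.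
Proof.
move=> k_gt0; rewrite /psum_hom /psum /= monalg.mmapU /= rmorph1 mul1r.
by rewrite /psum_hom_mon mdomU big_seq_fset1 cmUU expr1 prednK.
Qed.

Lemma psum_homZ c F : psum_hom (c *: F) = iota c * psum_hom F.
Proof. by rewrite /psum_hom /= monalg.mmapZ. Qed.

End PsumHom.

Lemma rmorph_psum_hom (R : realType) (A B : comNzRingType)
    (iota : {rmorphism R -> A}) (iota' : {rmorphism R -> B})
    (phi : {rmorphism A -> B}) p p' F :
  (forall c, phi (iota c) = iota' c) -> (forall k, phi (p k.+1) = p' k.+1) ->
  phi (psum_hom iota p F) = psum_hom iota' p' F.
Proof.
move=> phi_iota phi_p; rewrite !psum_homE rmorph_sum; apply: eq_bigr => m _.
rewrite rmorphM phi_iota /psum_hom_mon rmorph_prod; congr (_ * _).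
by apply: eq_bigr => i _; rewrite rmorphXn /= phi_p.
Qed.

Lemma sym_evalE (R : realType) N (F : Sym R) :
  sym_eval R N F = psum_hom (@mpolyC N R) (fun k => \sum_(j < N) 'X_j ^+ k) F.
Proof. by []. Qed.

(** * The functionals as coefficients, and the passage to finitely many variables *)

Section Planch.
Variable R : realType.

Definition planch_psum (k : nat) : {poly R} :=
  if k is 1 then 'X else if k is 2 then 1 else 0.

Definition planch_hom : {rmorphism Sym R -> {poly R}} :=
  psum_hom (@polyC R) planch_psum.

Lemma count_cmonom_part (m : {cmonom nat}) k :
  count_mem k (cmonom_part m) = if k is i.+1 then m i else 0%N.
Proof.
rewrite /cmonom_part (seq.permP (permEl (perm_sort _ _))) count_flatten -map_comp.
rewrite sumnE big_map; under eq_bigr => i _ do rewrite /= count_nseq /=.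
case: k => [|k]; first by rewrite big1.
case: (mdomP m k) => k_m; last first.
  rewrite big1_seq // => i /= i_m; case: eqP => // - [ik].
  by rewrite -ik i_m in k_m.
rewrite (big_fsetD1 k) //= eqxx mul1n big1_seq ?addn0 // => i /=.
by rewrite in_fsetD1 eqSS => /andP [/negbTE ->].
Qed.

Lemma cmonom_part_eq (m : {cmonom nat}) rho : is_part rho ->
  (cmonom_part m = rho) <-> (forall i, m i = count_mem i.+1 rho).
Proof.
case/andP => srt rho0; split=> [<- i|mE]; first by rewrite count_cmonom_part.
have geq_anti : antisymmetric geq by move=> i j; rewrite -eqn_leq => /eqP.
apply: (sorted_eq geq_trans geq_anti _ srt).
  by apply: sort_sorted => i j; apply: leq_total.
apply/allP => k _ /=; apply/eqP; rewrite count_cmonom_part; case: k => [|k //].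
by rewrite (count_memPn rho0).
Qed.

Lemma planch_mon_pow (m : {cmonom nat}) : (forall i, (1 < i)%N -> m i = 0%N) ->
  psum_hom_mon planch_psum m = 'X ^+ m 0%N.
Proof.
move=> m0; rewrite (@psum_hom_monE _ _ [fset 0%N; 1%N]%fset).
  rewrite big_fsetU1 ?big_seq_fset1 /= ?expr1n ?mulr1 //.
  by rewrite in_fset1.
apply/fsubsetP => i; rewrite !inE -cmE_neq0; case: i => [//|[//|i]].
by rewrite m0.
Qed.

Lemma planch_mon0 (m : {cmonom nat}) i : (1 < i)%N -> m i != 0%N ->
  psum_hom_mon planch_psum m = 0.
Proof.
move=> i_gt1 mi; have i_m : i \in finsupp m by rewrite -cmE_neq0.
rewrite /psum_hom_mon (big_fsetD1 i) //=.
by case: i i_gt1 mi {i_m} => [|[|i]] // _ mi; rewrite expr0n (negbTE mi) mul0r.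
Qed.

(** A monomial containing some [p_i] with [i > 2] is sent to 0, any other to ['X] to the
    multiplicity of 1, whatever the multiplicity of 2. *)
Lemma coef_planch_mon (m : {cmonom nat}) k :
  (psum_hom_mon planch_psum m)`_k =
  `[< exists n, cmonom_part m = nseq n 2%N ++ nseq k 1%N >]%:R.
Proof.
have part_nk n : is_part (nseq n 2%N ++ nseq k 1%N).
  rewrite /is_part mem_cat !mem_nseq !andbF andbT (sorted_pairwise geq_trans).
  rewrite pairwise_cat -!(sorted_pairwise geq_trans).
  apply/and3P; split; last 2 first.
  - by case: n => // n /=; elim: n.
  - by case: k => // k /=; elim: k.
  by apply/allrelP => i j; rewrite !mem_nseq => /andP[_ /eqP ->] /andP[_ /eqP ->].
have countE n i : count_mem i.+1 (nseq n 2%N ++ nseq k 1%N) =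
    ((i == 1) * n + (i == 0) * k)%N.
  by rewrite count_cat !count_nseq /= !eqSS ![_ == i]eq_sym.
have [[i i_gt1 mi]|m_small] := pselect (exists2 i, (1 < i)%N & m i != 0%N).
  rewrite (planch_mon0 i_gt1 mi) coef0 asboolF // => -[n].
  move=> /(cmonom_part_eq _ (part_nk n))/(_ i); rewrite countE => mi0.
  by move: mi; rewrite mi0; case: i i_gt1 {mi0} => [|[]].
have {}m_small i : (1 < i)%N -> m i = 0%N.
  by move=> i_gt1; have [//|mi] := eqVneq (m i) 0%N; case: m_small; exists i.
rewrite planch_mon_pow // coefXn; congr (_%:R); congr (nat_of_bool _).
apply/eqP/asboolP => [m0|[n]].
  exists (m 1%N); apply/cmonom_part_eq => // i; rewrite countE.
  by case: i => [|[|i]]; [rewrite -m0 | | rewrite m_small]; rewrite ?eqSS /=; lia.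
by move=> /(cmonom_part_eq _ (part_nk n))/(_ 0%N); rewrite countE /= mul1n mul0n.
Qed.

Lemma PlanchE_hom (F : Sym R) : PlanchE F = (planch_hom F)`_0.
Proof.
rewrite psum_homE /PlanchE /psum_functional coef_sum; apply: eq_bigr => m _.
rewrite coefCM coef_planch_mon; congr (_ * _%:R); congr (nat_of_bool _).
by apply: asbool_equiv_eq; split=> -[n ->]; exists n; rewrite cats0.
Qed.

Lemma PlanchO_hom (F : Sym R) : PlanchO F = (planch_hom F)`_1.
Proof.
rewrite psum_homE /PlanchO /psum_functional coef_sum; apply: eq_bigr => m _.
rewrite coefCM coef_planch_mon; congr (_ * _%:R); congr (nat_of_bool _).
by apply: asbool_equiv_eq; split=> -[n ->]; exists n; rewrite cats1.
Qed.

(* At delta = 1/L with L = 2 (M + 1) these are the power sums of M + 1 points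
   sqrt delta, M + 1 points - sqrt delta and L points delta X; at delta = 0 they
   are the values of planch_psum. *)
Definition deformed_psum (k : nat) : {poly {poly R}} :=
  ('X ^+ k)%:P * 'X ^+ k.-1 + (if odd k then 0 else 'X ^+ (k./2).-1).

Definition deformed_hom : {rmorphism Sym R -> {poly {poly R}}} :=
  psum_hom ((@polyC {poly R}) \o (@polyC R)) deformed_psum.

Lemma deformed_hom0 F : (deformed_hom F).[0] = planch_hom F.
Proof.
rewrite -[LHS]/(horner_eval 0 _); apply: rmorph_psum_hom => [c|k] /=.
  by rewrite /horner_eval hornerC.
rewrite /horner_eval /deformed_psum hornerD hornerM hornerC hornerXn.
case: k => [|[|k]] /=; first by rewrite horner0 expr0 mulr1 addr0.
  by rewrite hornerXn expr0 expr0n mulr0 add0r.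
rewrite expr0n mulr0 add0r negbK; case: ifP => [_|]; first by rewrite horner0.
by case: k => [//|[|k]] //= _; rewrite hornerXn /= expr0n.
Qed.

Section Points.
Variable M : nat.
Let L := (M.+1 + M.+1)%N.
Let e : R := L%:R^-1.

Definition deformed_point (j : 'I_(L + L)) : {poly R} :=
  match split j with
  | inl i => if split i then (Num.sqrt e)%:P else (- Num.sqrt e)%:P
  | inr _ => e%:P * 'X
  end.

(** The [L] points [e X] give [e^(k-1) X^k] in degree [k]; the points [sqrt e] and [- sqrt e] cancel
    in odd degree and give [L e^(k/2)] in even degree, where [L e = 1]. *)
Lemma deformed_point_psum k :
  \sum_(j < L + L) deformed_point j ^+ k.+1 = (deformed_psum k.+1).[e%:P].
Proof.
have L_neq0 : L%:R != 0 :> R by rewrite pnatr_eq0.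
have e_ge0 : 0 <= e by rewrite invr_ge0 ler0n.
rewrite big_split_ord /= [X in X + _]big_split_ord /=.
have ptE (u : 'I_L + 'I_L) : deformed_point (unsplit u) = match u with
    | inl i => if split i then (Num.sqrt e)%:P else (- Num.sqrt e)%:P
    | inr _ => e%:P * 'X
    end by rewrite /deformed_point unsplitK.
have plusE i : deformed_point (lshift L (lshift M.+1 i)) = (Num.sqrt e)%:P.
  by rewrite (ptE (inl _)) (unsplitK (inl _)).
have minusE i : deformed_point (lshift L (rshift M.+1 i)) = (- Num.sqrt e)%:P.
  by rewrite (ptE (inl _)) (unsplitK (inr _)).
under eq_bigr => i _ do rewrite plusE.
under [X in _ + X + _]eq_bigr => i _ do rewrite minusE.
under [X in _ + X]eq_bigr => i _ do rewrite (ptE (inr i)).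
rewrite /= !sumr_const !card_ord /deformed_psum hornerD hornerM hornerC hornerXn.
have eL : e%:P * L%:R = 1 :> {poly R}.
  by rewrite -(rmorph_nat polyC) -polyCM mulVf.
rewrite addrC; congr (_ + _).
  rewrite -mulr_natr exprMn exprS [LHS](_ : _ = e%:P * L%:R * ('X ^+ k.+1 * e%:P ^+ k)).
    by rewrite eL mul1r.
  by ring.
rewrite polyCN exprNn -signr_odd; case: ifP => odd_k.
  by rewrite expr1 mulN1r mulNrn subrr horner0.
rewrite mul1r -mulrnDr hornerXn -mulr_natr.
have kE : k.+1 = (k.+1./2.-1.+1).*2.
  by rewrite prednK; [rewrite -[LHS]odd_double_half odd_k | case: (k) odd_k].
rewrite {1}kE -mul2n exprM -polyC_exp sqr_sqrtr // exprSr -mulrA eL mulr1.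
by [].
Qed.

(** At [delta = 1/L] the deformed homomorphism factors through [2 L] variables, by substitution of
    the points. *)
Lemma sym_eval_deformed F : sym_eval R (L + L) F = 0 -> (deformed_hom F).[e%:P] = 0.
Proof.
move=> F0; pose phi : {rmorphism mpoly (L + L) R -> {poly R}} :=
  mpoly.mmap (@polyC R) deformed_point.
have <- : phi (sym_eval R (L + L) F) = (deformed_hom F).[e%:P].
  rewrite -[RHS]/(horner_eval e%:P _) sym_evalE.
  transitivity (psum_hom (@polyC R) (fun k => (deformed_psum k).[e%:P]) F).
    apply: rmorph_psum_hom => [c|k] /=; first by rewrite mpoly.mmapC.
    rewrite -deformed_point_psum raddf_sum; apply: eq_bigr => j _ /=.
    by rewrite rmorphXn /= mpoly.mmapX mmap1U.
  by apply/esym/rmorph_psum_hom => [c|k] //=; rewrite /horner_eval hornerC.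
by rewrite F0 rmorph0.
Qed.

End Points.

(* deformed_hom F is a polynomial in delta with infinitely many zeros 1/L. *)
Lemma planch_hom_eq0 (F : Sym R) n :
  (forall N, (n <= N)%N -> sym_eval R N F = 0) -> planch_hom F = 0.
Proof.
move=> F0; rewrite -deformed_hom0.
suff -> : deformed_hom F = 0 by rewrite horner0.
pose pt M : {poly R} := ((M.+1 + M.+1)%:R^-1)%:P.
apply: (@roots_geq_poly_eq0 _ _ [seq pt M | M <- iota n (size (deformed_hom F))]).
- apply/allP => x /mapP[M + ->]; rewrite mem_iota => /andP[n_M _].
  by rewrite /root sym_eval_deformed // F0 //; lia.
- rewrite map_inj_uniq ?iota_uniq // => M1 M2 /polyC_inj/invr_inj/eqP.
  by rewrite eqr_nat => /eqP; lia.
by rewrite size_map size_iota.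
Qed.

End Planch.

(** * Euler's identity and base cases for the Plancherel homomorphism *)

Section PlanchJing.
Variables (R : realType) (t : R) (q : nat -> {poly R}).
Hypothesis nq : newton t%:P (planch_psum R) q.

Lemma planch_newton1 : q 1%N = (1 - t)%:P * 'X.
Proof. by have := nq.2 0%N; rewrite big_ord1 nq.1 mulr1n /= mulr1 polyCB. Qed.

Lemma planch_newtonSS r :
  q r.+2 *+ r.+2 = (1 - t)%:P * 'X * q r.+1 + (1 - t ^+ 2)%:P * q r.
Proof.
rewrite nq.2 !big_ord_recl /= big1 ?addr0 => [|k _]; last by rewrite mulr0 mul0r.
by rewrite !subSS !subn0 mulr1 !polyCB polyC_exp.
Qed.

(** The [z]-derivative of [exp ((1 - t) z u + (1 - t^2) u^2 / 2)] is [(1 - t) u] times the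
    series. *)
Lemma planch_newton_deriv r : (q r.+1)^`() = (1 - t)%:P * q r.
Proof.
elim/ltn_ind: r => -[|r] IH.
  by rewrite planch_newton1 derivM derivC derivX nq.1 mul0r add0r.
have char0 : r.+2%:R != 0 :> {poly R} by rewrite -(rmorph_nat polyC) polyC_eq0 pnatr_eq0.
apply: (mulfI char0); rewrite !mulr_natl -derivMn planch_newtonSS derivD !derivM.
rewrite !derivC derivX IH //; case: r IH {char0} => [|r] IH.
  by rewrite nq.1 planch_newton1 derivC; ring.
by rewrite IH // -[RHS]mulrnAr [in RHS]mulrS planch_newtonSS; ring.
Qed.

(** This is [derivation_jing] for [z d/dz], which multiplies the coefficient of [z^k] by [k], with
    [c = 1 - t^2]. *)
Lemma planch_euler (k : nat) al :
  ((\sum_(m <- al) m)%:~R - k%:R) * (jing t%:P (extend0 q) al)`_k =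
  (1 - t ^+ 2) * \sum_(be <- lowers al) (jing t%:P (extend0 q) be)`_k.
Proof.
have d_der : is_derivation (fun f : {poly R} => 'X * f^`()).
  by split=> f g; rewrite ?derivD ?derivM; ring.
have dq r : 'X * (extend0 q r)^`() =
    r%:~R * extend0 q r - (1 - t ^+ 2)%:P * extend0 q (r - 2).
  case: r => [[|[|r]]|r] /=; last by rewrite deriv0 !mulr0 subr0.
  - by rewrite nq.1 derivC !mulr0 mul0r subr0.
  - by rewrite planch_newton_deriv planch_newton1 nq.1 mulr0 subr0; ring.
  rewrite planch_newton_deriv add0n subSS subSS subn0.
  by rewrite -[r.+2%:~R]/(r.+2%:R) mulr_natl planch_newtonSS; ring.
have tP0 : 'X * (t%:P : {poly R})^`() = 0 by rewrite derivC mulr0.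
have /= := derivation_jing al d_der tP0 (@extend0_neg _ q) dq.
move/(congr1 (fun f : {poly R} => f`_k)).
rewrite coefXM coefB -(rmorph_int polyC) !coefCM coef_sum.
set b := jing _ _ al => dJ; rewrite mulrBl -[X in _ - X](_ : (if k == 0%N then 0
  else (b^`())`_k.-1) = _).
  by rewrite dJ; ring.
by case: (k) => [|j] /=; rewrite ?mul0r // coef_deriv mulr_natl.
Qed.

Lemma planch_base (k : nat) la : (k <= 1)%N -> t < 1 -> 0%N \notin la ->
  sumn la = k -> 0 <= n_sign R la * (jing t%:P (extend0 q) (map Posz la))`_k.
Proof.
move=> k_le1 t_lt1 la0 sum_la; rewrite -{k}sum_la in k_le1 *.
case: la la0 k_le1 => [|x la] /=.
  by move=> _ _; rewrite coef1 /n_sign /n_part big_ord0 mulr1.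
rewrite inE negb_or eq_sym -lt0n => /andP[x0 la0] le1.
have x1 : x = 1%N by lia.
have -> : la = [::].
  by case: la la0 le1 => [//|[//|y] la] /=; lia.
rewrite x1 coef_pairing1 /= planch_newton1 coefCM coefX /=.
by rewrite /n_sign /n_part big_ord1 mul1r mulr1 subr_ge0 ltW.
Qed.

Lemma planch_jing_ge0 (k : nat) la : -1 < t < 0 -> (k <= 1)%N -> is_part la ->
  odd (sumn la) = odd k ->
  0 <= n_sign R la * (jing t%:P (extend0 q) (map Posz la))`_k.
Proof.
move=> ht k_le1 /andP[srt la0] par.
have neg := @extend0_neg _ q.
pose b al := (jing t%:P (extend0 q) al)`_k.
apply: (@sign_positive R t b ht _ _ _ _ k) => //.
- by move=> al m m0; rewrite /b jing_cat_neg ?coef0.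
- by move=> al; rewrite /b jing_rcons0 //= nq.1.
- by move=> al s be; rewrite /b jing_swap1_cat // coefCM.
- move=> al s be; rewrite /b jing_swap2_cat // coefD coefCM -polyC1 -polyCB.
  by rewrite coefCM.
- move=> mu _ mu0 sum_mu; apply: planch_base => //.
  by case/andP: ht => _ /lt_trans; apply; exact: ltr01.
exact: planch_euler.
Qed.

End PlanchJing.

Lemma tofrac_inj (D : idomainType) : injective (@FracField.tofrac D).
Proof. by move=> x y /eqP; rewrite tofrac_eq => /eqP. Qed.

(** * Hall-Littlewood functions in finitely many variables as Jing products *)

Section HLJing.
Variables (R : realType) (t : R).
Hypothesis t_lt1 : `|t| < 1.

Let one_subX_neq0 j : 1 - t ^+ j.+1 != 0.
Proof.
rewrite subr_eq0; apply/eqP => e.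
have : `|t ^+ j.+1| < 1 by rewrite normrX exprn_ilt1.
by rewrite -e normr1 ltxx.
Qed.

Lemma sum_count_mem s (la : seq nat) : {in la, forall x, 0 < x <= s}%N ->
  (\sum_(1 <= i < s.+1) count_mem i la)%N = size la.
Proof.
elim: la => [|x la IH] la_s; first by rewrite big1.
rewrite /= big_split /= IH => [|y y_la]; last by rewrite la_s // inE y_la orbT.
rewrite -[RHS]add1n; congr addn; rewrite (bigD1_seq x) ?iota_uniq //=; last first.
  by rewrite mem_index_iota ltnS la_s // mem_head.
by rewrite eqxx big1 // => i /negbTE ne; rewrite eq_sym ne.
Qed.

(** The factor of the zero parts is [qint]; the remaining ones have [size la] denominators [1 - t]
    in all. *)
Lemma HL_v_qint N (la : seq nat) : 0%N \notin la ->
  (1 - t) ^+ size la * HL_v N t la =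
  qint t (N - size la) * \prod_(1 <= i < (sumn la).+1)
    \prod_(1 <= j < (count_mem i la).+1) (1 - t ^+ j).
Proof.
move=> la0; rewrite /HL_v big_nat_recl // mulrCA; congr (_ * _).
rewrite -(@sum_count_mem (sumn la)) => [|x x_la]; last first.
  have [x0|_] := posnP x; first by rewrite -x0 x_la in la0.
  by rewrite sumnE (big_rem x) //= leq_addr.
rewrite expr_sum !big_add1 /= -big_split /=; apply: eq_bigr => i _.
rewrite -[mult N la i.+1]/(count_mem i.+1 la); elim: (count_mem i.+1 la) => [|m IH].
  by rewrite !big_geq ?mulr1.
rewrite exprSr [X in _ * X = _]big_nat_recr //= [RHS]big_nat_recr //= -IH.
rewrite -!mulrA; congr (_ * _).
rewrite [LHS]mulrCA; congr (_ * _); rewrite mulrC divfK //.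
exact: (one_subX_neq0 0).
Qed.

Lemma HL_v_neq0 N la : HL_v N t la != 0.
Proof.
rewrite /HL_v prodf_seq_neq0; apply/allP => i _; apply/implyP => _.
rewrite prodf_seq_neq0; apply/allP => -[|j]; rewrite mem_index_iota // => _ /=.
by rewrite mulf_neq0 ?invr_neq0 //; apply: (one_subX_neq0 0).
Qed.

Let frac N : {rmorphism mpoly N R -> {fraction mpoly N R}} :=
  @FracField.tofrac (mpoly N R).
Let const N : {rmorphism R -> {fraction mpoly N R}} := frac N \o @mpolyC N R.

Lemma const_neq0 N c : c != 0 -> const N c != 0.
Proof. by rewrite fmorph_eq0. Qed.

Lemma sym_eval_jing (la : part) P q N :
  is_HL_P t la P -> newton (malgC t) (psum R) q -> (size la <= N)%N ->
  sym_eval R N (\prod_(1 <= i < (sumn la).+1)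
      \prod_(1 <= j < (count_mem i (la : seq nat)).+1) (1 - t ^+ j) *: P) =
  sym_eval R N (jing (malgC t) (extend0 q) (map Posz la)).
Proof.
move=> P_HL nq le_N; apply: tofrac_inj.
have la0 : 0%N \notin (la : seq nat) by case: (la) => s /= /andP[].
set b := \prod_(1 <= i < _) _.
pose x (i : 'I_N) : {fraction mpoly N R} := frac N 'X_i.
have x_inj : injective x.
  move=> i j /tofrac_inj/(congr1 (mpoly.mcoeff U_(i)%MM)).
  by rewrite !mcoeffXU eqxx; case: eqVneq => // _ /eqP; rewrite oner_eq0.
have char0 n : n.+1%:R != 0 :> {fraction mpoly N R}.
  by rewrite -(rmorph_nat (const N)) const_neq0 // pnatr_eq0.
pose q' := frac N \o (sym_eval R N \o q).
have nq' : newton (const N t) (power_sum x) q'.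
  have tE : sym_eval R N (malgC t) = t%:MP by rewrite /sym_eval /= monalg.mmapC.
  have := newton_rmorph (frac N) (newton_rmorph (sym_eval R N) nq).
  rewrite tE; apply: newton_ext => k /=; rewrite sym_eval_psum // rmorph_sum.
  by apply: eq_bigr => i _; rewrite rmorphXn.
have ct1 : 1 - const N t != 0.
  by rewrite -(rmorph1 (const N)) -rmorphB const_neq0 // (one_subX_neq0 0).
have jHL := jing_HL_sum char0 ct1 x_inj nq' la0 le_N.
have /(congr1 (const N)) := HL_v_qint N la0; rewrite !rmorphM rmorphXn rmorphB rmorph1.
have -> : const N (qint t (N - size la)) = qint (const N t) (N - size la).
  rewrite /qint rmorph_prod; apply: eq_bigr => j _.
  by rewrite fmorph_div !rmorphB rmorphXn rmorph1.
move=> vE; have cv0 := const_neq0 N (HL_v_neq0 N la).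
have -> : FracField.tofrac (sym_eval R N (b *: P)) =
    const N b * ((const N (HL_v N t la))^-1 * HL_sum (const N t) x la).
  by rewrite sym_evalC -mul_mpolyC tofracM (P_HL N le_N) -fmorphV.
have -> : FracField.tofrac
    (sym_eval R N (jing (malgC t) (extend0 q) (map Posz la))) =
    jing (const N t) (extend0 q') (map Posz la).
  rewrite -[LHS]/(frac N _) !jing_rmorph {1}/sym_eval /= monalg.mmapC.
  by apply: jing_ext => -[r|r] //=; rewrite !rmorph0.
(* Multiplication by [(1 - t)^(size la)] and [HL_v] brings both sides to the forms of [jing_HL_sum]
   and [HL_v_qint]. *)
apply: (mulfI (mulf_neq0 (expf_neq0 (size la) ct1) cv0)).
transitivity ((1 - const N t) ^+ size la * HL_sum (const N t) x la * const N b).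
  by rewrite -mulrA (mulrCA _ (const N b)) mulVKf // mulrCA mulrC.
by rewrite jHL [in RHS]vE -mulrA mulrC.
Qed.

End HLJing.

(** * Positivity on the cones and harmonicity *)

Section Main.
Variables (R : realType) (t : R).
Hypothesis ht : -1 < t < 0.

Let t_lt1 : `|t| < 1.
Proof. by case/andP: ht => t_gt t_lt; rewrite ltr_norml t_gt (lt_trans t_lt). Qed.

(** [Q_la] and Jing's element of [Sym R] agree in every number [N >= size la] of variables, so
    [planch_hom_eq0] gives them the same image, to which [planch_jing_ge0] applies. *)
Lemma coef_planch_HL_Qtilde (la : part) k : (k <= 1)%N -> odd (sumn la) = odd k ->
  0 <= (planch_hom R (HL_Qtilde t la))`_k.
Proof.
move=> k_le1 par; rewrite psum_homZ coefCM /HL_Qtilde /HL_Q /HL_P.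
(* If no P existed, HL_P would be 0 by default. *)
case: (pselect (exists P, is_HL_P t la P)) => [exP|noP]; last first.
  rewrite xgetPN; last by move=> P P_HL; apply: noP; exists P.
  by rewrite scaler0 rmorph0 coef0 mulr0.
have P_HL := xgetPex 0 exP; move: (xget _ _) P_HL => P P_HL.
have [q nq] : exists q, newton (malgC t) (psum R) q.
  pose iota : {rmorphism R -> Sym R} := @malgC {cmonom nat} R.
  by apply: (newton_exists iota) => n; rewrite pnatr_eq0.
set Q := _ *: P.
have /eqP : planch_hom R (Q - jing (malgC t) (extend0 q) (map Posz la)) = 0.
  apply: (@planch_hom_eq0 _ _ (size la)) => N le_N.
  by rewrite rmorphB; apply/eqP; rewrite subr_eq0; apply/eqP/sym_eval_jing.
rewrite rmorphB subr_eq0 => /eqP ->; rewrite jing_rmorph.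
have tE : planch_hom R (malgC t) = t%:P.
  by rewrite /planch_hom /psum_hom /= monalg.mmapC.
rewrite tE (@jing_ext _ _ _ (extend0 (planch_hom R \o q))); last first.
  by case=> r //=; rewrite rmorph0.
apply: planch_jing_ge0 => //; last by case: (la).
have := newton_rmorph (planch_hom R) nq; rewrite tE; apply: newton_ext => j.
exact: psum_hom_psum.
Qed.

End Main.

Theorem proposition8p12 (R : realType) (t : R) (ht : -1 < t < 0) :
  ((forall F : Sym R, Sym_parity false F ->
      PlanchE (psum R 2 * F) = PlanchE F) /\
   (forall F : Sym R, HL_cone false t F -> 0 <= PlanchE F)) /\
  ((forall F : Sym R, Sym_parity true F ->
      PlanchO (psum R 2 * F) = PlanchO F) /\
   (forall F : Sym R, HL_cone true t F -> 0 <= PlanchO F)).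
Proof.
have harm F : planch_hom R (psum R 2 * F) = planch_hom R F.
  by rewrite rmorphM psum_hom_psum //= mul1r.
(* The boolean [k] is both the parity of the degrees and, read as 0 or 1, the index of the
   coefficient. *)
have pos (k : bool) F : HL_cone k t F -> 0 <= (planch_hom R F)`_k.
  move=> [n [c [u [c_ge0 u_Q ->]]]]; rewrite rmorph_sum coef_sum.
  apply: sumr_ge0 => i _; rewrite psum_homZ coefCM mulr_ge0 //.
  have [la par ->] := u_Q i; apply: coef_planch_HL_Qtilde => //.
    by case: (k).
  by rewrite par; case: (k).
split; split=> F; rewrite ?PlanchE_hom ?PlanchO_hom ?harm //.
- exact: (pos false).
- exact: (pos true).
Qed.
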